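(* Let $k\ge 2$ and let $f:(0,\infty)\to[0,\infty)$. Then $f\in\mathcal{S}_k$ if and only if there exist a real number $a_k\ge 0$ and a non-negative measure $\mu_k(dt)$ on $[0,\infty)$ with $\int_{[0,\infty)}(1+t)^{-1}\,\mu_k(dt)<\infty$ such that, for all $x>0$, $$f(x)\;=\;a_k\;+\;\int_{[0,\infty)}\Phi_{k-1}(x,t)\,\mu_k(dt).$$
   Context: All functions are real functions defined on $(0,\infty)$; $h^{(n)}$ is the $n$-th derivative, and derivatives are taken in the measure sense where needed (the first derivative of a convex function is its right derivative, and its second derivative is a non-negative measure). For $k\ge 1$, a non-negative function $f$ is a $k$-Stieltjes function, written $f\in\mathcal{S}_k$, if $(-1)^{n-1}(x^n f)^{(2n-1)}\ge 0$ for all $n=1,\dots,k$. Explicitly: for $k=1$ this means that $xf(x)$ is non-decreasing; for $k\ge 2$ it means that $f$ is of class $\mathcal{C}^{2k-3}$, that $(-1)^{n-1}(x^n f)^{(2n-1)}\ge 0$ pointwise for $n=1,\dots,k-1$, and that $(-1)^{k-1}(x^k f)^{(2k-3)}$ is a convex function. For integers $k\ge 0$ set $$P_k(x)=\sum_{n=0}^k\binom{2k}{n+k}(-x)^n,\qquad \hat P_k(x)=P_k(x)-P_k(0),$$ and for $(x,t)\in(0,\infty)\times[0,\infty)$ $$\Phi_k(x,t)=\frac1x\Big(P_k(tx^{-1})\,\mathbf{1}_{\{x\ge t\}}-\hat P_k(xt^{-1})\,\mathbf{1}_{\{x<t\}}\Big).$$ These kernels are non-negative. *)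

(* Defs.v *)
From HB Require Import structures.
From mathcomp Require Import all_boot all_order all_algebra.
From mathcomp Require Import all_classical all_reals all_analysis.

Set Implicit Arguments.
Unset Strict Implicit.
Unset Printing Implicit Defensive.

Import Order.TTheory GRing.Theory Num.Theory.
Import numFieldNormedType.Exports.

Local Open Scope classical_set_scope.
Local Open Scope ring_scope.

(* A function on (0, +oo) is represented by a total function R -> R whose
   values outside (0, +oo) are never inspected: the conditions below only
   depend on the germs of the function at points x > 0. *)

(* Since derive1n is total, the differentiability requirement makes the
   iterated derivatives meaningful on (0, +oo); continuity of the derivatives
   of order < m is then automatic. *)
Definition class_C (R : realType) (m : nat) (f : R -> R) : Prop :=
  (forall (j : nat) (x : R), (j < m)%N -> 0 < x -> derivable (derive1n j f) x 1) /\
  (forall x : R, 0 < x -> {for x, continuous (derive1n m f)}).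

(* Meant for 1 <= k; for k = 0 only non-negativity remains. *)
Definition k_stieltjes (R : realType) (k : nat) (f : R -> R) : Prop :=
  [/\ forall x : R, 0 < x -> 0 <= f x,
      k = 1%N -> {in `]0, +oo[ &, {homo (fun x : R => x * f x) : x y / x <= y}}
    & (2 <= k)%N ->
      [/\ class_C (2 * k - 3)%N f,
          forall (n : nat) (x : R), (1 <= n <= k - 1)%N -> 0 < x ->
            0 <= (-1) ^+ (n - 1) * derive1n (2 * n - 1)%N (fun y : R => y ^+ n * f y) x
        & convex_function (E := R^o) `]0%R, +oo[%classic
            (fun x : R =>
               (-1) ^+ (k - 1) * derive1n (2 * k - 3)%N (fun y : R => y ^+ k * f y) x)]].

Definition stieltjes_P (R : realType) (k : nat) (x : R) : R :=
  \sum_(0 <= n < k.+1) 'C(2 * k, n + k)%:R * (- x) ^+ n.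

Definition stieltjes_Phat (R : realType) (k : nat) (x : R) : R :=
  stieltjes_P k x - stieltjes_P k 0.

(* Used for x > 0 and t >= 0 only. *)
Definition stieltjes_Phi (R : realType) (k : nat) (x t : R) : R :=
  x^-1 * (stieltjes_P k (t * x^-1) * \1_[set s : R | s <= x] t
          - stieltjes_Phat k (x * t^-1) * \1_[set s : R | x < s] t).

(* Main.v *)
Require Import Defs.
From HB Require Import structures.
From mathcomp Require Import all_boot all_order all_algebra.
From mathcomp Require Import all_classical all_reals all_analysis.
From mathcomp Require Import measurable_realfun.
From mathcomp Require Import ring lra zify polyrcf.

Set Implicit Arguments.
Unset Strict Implicit.
Unset Printing Implicit Defensive.

Import Order.TTheory GRing.Theory Num.Theory.
Import numFieldNormedType.Exports.

Local Open Scope ring_scope.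
Local Open Scope classical_set_scope.

(** Put K = k - 1 >= 1 and, for a function w on the open half-line,
      G_n = (-1)^(n-1) (x^n w)^(2n-1)   and   g_n = (-1)^n (x^(n+1) w)^(2n-1).
    A function w >= 0 of class C^(2K-1) belongs to S_k when G_1, ..., G_K >= 0
    and g_K is convex.

    The engine of both directions is a descent.  Leibniz' rule gives
    g_n'' = G_(n+1), and the derivative of x^(2n) G_n is - x^(2n-1) g_n'.
    If g_n is convex and G_n has a non-negative lower limit at infinity, then
    g_n cannot increase anywhere: a positive slope would persist and drive G_n
    below a negative constant.  Hence x^(2n) G_n is non-decreasing, and a
    non-negative lower limit at 0 makes G_n non-negative.  Then g_(n-1) is
    convex, and the argument continues down to n = 1 ([level_nonneg],
    [descent]).  So, given boundary behaviour, convexity at the top level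
    implies all the other sign conditions.

    Sufficiency.  For t > 0 the kernel Phi_K(., t) is of the form
    x^p phi(t/x), with phi given by one polynomial in t/x below the diagonal
    and another in x/t above it, and the two branches agree at x = t up to a
    zero of order 2K, because the signed binomial coefficients of order 2K sum
    to (1 - X)^(2K) ([gap_poly]).  Kernels of this form are stable under d/dx
    ([is_derive_kern]) and are dominated by a multiple of x^p x/(x + t)
    ([kern_bound]), so the potential I = int Phi_K dmu can be differentiated
    2K - 1 times under the integral sign.  At the top level the kernel of g_K
    is, up to a constant, (2K)! t^(-K) (t - x)_+ ([kern_jet_top]), which is
    convex; the bounds give the boundary behaviour, and the descent yields all
    signs ([st_level_potential_ge0]).  The same argument for a Dirac mass
    shows that Phi_K is non-negative.

    Necessity.  The kernel at the top level forces (2K)! t^(-K) mu(dt) to be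
    the second derivative of g_K; conversely the right slope of g_K defines
    mu on the open half-line ([representing_measure_ex]).  Finiteness is the
    difficulty.  For the restriction of mu to a compact interval, g_K[f - I]
    is still convex ([convex_pos_subtract]), so the descent gives I <= f for
    every truncation, and monotone convergence bounds int Phi_K(x, t) mu(dt)
    by f(x).  As 1/(1 + t) is controlled by two functions Phi_K(x, .)
    ([weight_le_Phi]), mu is admissible ([integrable_pos]).  For the whole
    measure g_K[f - I] is affine, hence x^(K+1) (f - I) is a polynomial, and
    since f - I satisfies the sign conditions it can only be a + b/x with
    a, b >= 0 ([polynomial_remainder]).  The term b/x is the
    contribution of an atom at t = 0. *)

(** * Iterated derivatives on the open half-line *)

Section jets.
Context {R : realType}.
Implicit Types (f g : R -> R) (u v : nat -> R -> R).

(** An explicit chain of successive derivatives.  Producing one computes every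
    iterated derivative at once ([jet_derive1n]), since derivatives at x > 0
    depend only on the values on the open half-line. *)
Definition jet (m : nat) u :=
  forall (j : nat) (x : R), (j < m)%N -> 0 < x -> is_derive x 1 (u j) (u j.+1 x).

Lemma is_derive_exprn n (s : R) :
  is_derive s (1 : R) (fun s : R => s ^+ n) (n%:R * s ^+ n.-1).
Proof.
rewrite (_ : (fun s => _) = id ^+ n); last by apply/funext => y; rewrite exprfctE.
apply: is_derive_eq (is_deriveX n (is_derive_id s (1 : R))) _.
by rewrite /GRing.scale /= mulr1.
Qed.

Lemma near_gt0 (x : R) : 0 < x -> \forall y \near x, 0 < y.
Proof. by move=> x0; exact: lt_nbhsr. Qed.

Lemma is_derive_germ f g (x d : R) : (forall y, 0 < y -> f y = g y) -> 0 < x ->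
  is_derive x 1 f d -> is_derive x 1 g d.
Proof.
move=> fg x0; apply: near_eq_is_derive.
by near=> y; apply: fg; near: y; exact: near_gt0.
Unshelve. all: by end_near. Qed.

Lemma is_derive1_val f (x d : R) : is_derive x 1 f d -> f^`() x = d.
Proof. by case=> _ dfd; rewrite derive1E. Qed.

Lemma derive1n_germ n f g : (forall y, 0 < y -> f y = g y) ->
  forall x, 0 < x -> derive1n n f x = derive1n n g x.
Proof.
move=> fg; elim: n => [|n ih] x x0; first exact: fg.
rewrite !derive1nS !derive1E; apply: near_eq_derive.
by near=> y; apply: ih; near: y; exact: near_gt0.
Unshelve. all: by end_near. Qed.

Lemma jet_eq m u v : (forall j x, (j <= m)%N -> 0 < x -> u j x = v j x) ->
  jet m u -> jet m v.
Proof.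
move=> uv ju j x jm x0; rewrite -uv//.
by apply: is_derive_germ (ju j x jm x0) => // y y0; rewrite uv// ltnW.
Qed.

Lemma jet_derive1n m u f : (forall x, 0 < x -> f x = u 0%N x) -> jet m u ->
  forall j x, (j <= m)%N -> 0 < x -> derive1n j f x = u j x.
Proof.
move=> fu ju; elim=> [|j ih] x jm x0; first exact: fu.
rewrite derive1nS; apply: is_derive1_val.
apply: is_derive_germ (ju j x jm x0) => // y y0.
by rewrite ih// ltnW.
Qed.

Lemma jet_of_derive1n m u f : (forall x, 0 < x -> f x = u 0%N x) -> jet m u ->
  jet m (fun j => derive1n j f).
Proof.
move=> fu ju; apply: (jet_eq _ ju) => j x jm x0.
by rewrite (jet_derive1n fu ju).
Qed.

Lemma class_C_jet m f : class_C m f -> jet m (fun j => derive1n j f).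
Proof.
move=> [df _] j x jm x0; split; first exact: df.
by rewrite derive1nS derive1E.
Qed.

Lemma jet_leq m n u : (n <= m)%N -> jet m u -> jet n u.
Proof. by move=> nm ju j x jn x0; apply: ju => //; exact: leq_trans nm. Qed.

Lemma jetD m u v : jet m u -> jet m v -> jet m (fun j x => u j x + v j x).
Proof.
by move=> ju jv j x jm x0; have := ju _ _ jm x0; have := jv _ _ jm x0; move=> ? ?;
  exact: is_deriveD.
Qed.

Lemma jetZ m c u : jet m u -> jet m (fun j x => c * u j x).
Proof.
by move=> ju j x jm x0; have := ju _ _ jm x0 => ?; exact: is_deriveZ.
Qed.

Lemma jet_mulX m u : jet m u -> jet m (fun j x => x * u j x + j%:R * u j.-1 x).
Proof.
move=> ju j x jm x0.
have D0 := ju _ _ jm x0.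
have D1 : is_derive x 1 (fun y => j%:R * u j.-1 y) (j%:R * u j x).
  case: j jm {D0} => [|j] jm.
    rewrite mul0r; apply: (@is_derive_germ (cst 0)) => //.
    by move=> y _; rewrite mul0r.
  have := ju _ _ (ltnW jm) x0 => ?; exact: is_deriveZ.
have D2 := @is_deriveM _ _ _ _ _ _ _ _ (is_derive_id x (1 : R)) D0.
apply: is_derive_eq (@is_deriveD _ _ _ _ _ _ _ _ _ D2 D1) _.
by rewrite /= /GRing.scale /= -[in RHS]natr1; ring.
Qed.


Definition smooth m f := jet m (fun j => derive1n j f).

(** (x^n f)^(j), the building block of every sign condition. *)
Definition derive_Xn n j f : R -> R := derive1n j (fun y => y ^+ n * f y).

(** Induction on n with [jet_mulX]: only multiplication by x is ever
    differentiated. *)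
Lemma smooth_powM m n f : smooth m f -> smooth m (fun y => y ^+ n * f y).
Proof.
move=> sf; elim: n => [|n ih].
  by apply: jet_of_derive1n sf => x x0; rewrite expr0 mul1r.
apply: jet_of_derive1n (jet_mulX ih) => x x0.
by rewrite mul0r addr0 exprS mulrA.
Qed.

Lemma derive_X0 j f : derive_Xn 0 j f = derive1n j f.
Proof. by rewrite /derive_Xn; under eq_fun do rewrite expr0 mul1r. Qed.

(** Leibniz' rule for x times (x^n f): the one relation that ties consecutive
    levels together. *)
Lemma derive_XnS m n j f x : smooth m f -> (j <= m)%N -> 0 < x ->
  derive_Xn n.+1 j f x = x * derive_Xn n j f x + j%:R * derive_Xn n j.-1 f x.
Proof.
move=> sf jm x0.
apply: (jet_derive1n _ (jet_mulX (smooth_powM n sf)) jm x0) => y y0.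
by rewrite mul0r addr0 exprS mulrA.
Qed.

Lemma derive_Xn_jet m n f : smooth m f -> jet m (fun j => derive_Xn n j f).
Proof. exact: smooth_powM. Qed.

Lemma derive_Xn_germ n j f g : (forall y, 0 < y -> f y = g y) ->
  forall x, 0 < x -> derive_Xn n j f x = derive_Xn n j g x.
Proof.
by move=> fg x x0; apply: derive1n_germ => // y y0; rewrite fg.
Qed.

Lemma derive_XnDZ m n j f g c x : smooth m f -> smooth m g -> (j <= m)%N -> 0 < x ->
  derive_Xn n j (fun y => f y + c * g y) x = derive_Xn n j f x + c * derive_Xn n j g x.
Proof.
move=> sf sg jm x0.
apply: (jet_derive1n _ (jetD (derive_Xn_jet n sf) (jetZ c (derive_Xn_jet n sg))) jm x0).
by move=> y y0; rewrite /derive_Xn /=; ring.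
Qed.

Lemma smoothDZ m f g c : smooth m f -> smooth m g ->
  smooth m (fun y => f y + c * g y).
Proof.
by move=> sf sg; apply: jet_of_derive1n (jetD sf (jetZ c sg)).
Qed.

End jets.

(** * Convex functions on the open half-line *)

Section convexity.
Context {R : realType}.
Implicit Types (f g h : R -> R).

(** The chord inequality with denominators cleared, so that coinciding points
    are harmless. *)
Definition convex_pos g := forall x y z : R, 0 < x -> x <= y -> y <= z ->
  (z - x) * g y <= (z - y) * g x + (y - x) * g z.

Lemma le_of_derive f f' (a b : R) : a <= b ->
  (forall s, a <= s <= b -> is_derive s (1 : R) f (f' s)) ->
  (forall s, a <= s <= b -> 0 <= f' s) -> f a <= f b.
Proof.
move=> ab df f'0.
have sub s : s \in `]a, b[%R -> a <= s <= b.
  by rewrite in_itv/= => /andP[/ltW -> /ltW ->].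
have h : {in `[a, b]%R &, {homo f : x y / x <= y}}; last first.
  by apply: h; rewrite ?in_itv/= ?lexx ?ab.
apply: ger0_derive1_le_cc.
- by move=> s /sub sab; have [] := df s sab.
- by move=> s /sub sab; rewrite (is_derive1_val (df s sab)); exact: f'0.
- by apply: derivable_within_continuous => s; rewrite in_itv/= => sab;
  have [] := df s sab.
Qed.

(** The tangent at the middle point lies below the function; combining the two
    endpoint inequalities with weights z - y and y - x eliminates the slope. *)
Lemma convex_pos_of_jet (u : nat -> R -> R) : jet 2 u ->
  (forall x : R, 0 < x -> 0 <= u 2%N x) -> convex_pos (u 0%N).
Proof.
move=> ju u2 x y z x0 xy yz.
have y0 : 0 < y by exact: lt_le_trans xy.
have u1 (a b : R) : 0 < a -> a <= b -> u 1%N a <= u 1%N b.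
  move=> a0 ab; apply: (@le_of_derive _ (u 2%N)) => // s /andP[as_ sb].
    by apply: ju => //; exact: lt_le_trans as_.
  by apply: u2; exact: lt_le_trans as_.
have dl (s : R) : 0 < s -> is_derive s (1 : R) (fun s : R =>
  u 0%N s - s * u 1%N y) (u 1%N s - u 1%N y).
  move=> s0.
  have D0 := ju 0%N _ isT s0.
  have D1 := @is_deriveM _ _ _ _ _ _ _ _ (is_derive_id s (1 : R)) (is_derive_cst (u 1%N
    y) s 1).
  apply: is_derive_eq (@is_deriveB _ _ _ _ _ _ _ _ _ D0 D1) _.
  by rewrite /= /GRing.scale /=; ring.
have H1 : u 0%N y - y * u 1%N y <= u 0%N x - x * u 1%N y.
  rewrite -lerN2.
  apply: (@le_of_derive (fun s : R => - (u 0%N s - s * u 1%N y)) (fun s : R =>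
    - (u 1%N s - u 1%N y))) => // s /andP[xs sy].
    have s0 := lt_le_trans x0 xs.
    by apply: is_deriveN; exact: dl.
  by rewrite oppr_ge0 subr_le0 u1// (lt_le_trans x0).
have H2 : u 0%N y - y * u 1%N y <= u 0%N z - z * u 1%N y.
  apply: (@le_of_derive (fun s : R => (u 0%N s - s * u 1%N y)) (fun s : R =>
    (u 1%N s - u 1%N y))) => // s /andP[xs sy].
    have s0 := lt_le_trans y0 xs.
    by exact: dl.
  by rewrite subr_ge0 u1.
have := ler_wpM2l (_ : 0 <= z - y) H1; rewrite subr_ge0 => /(_ yz).
have := ler_wpM2l (_ : 0 <= y - x) H2; rewrite subr_ge0 => /(_ xy).
lra.
Qed.

Lemma convex_pos_eq f g : (forall x, 0 < x -> f x = g x) -> convex_pos f ->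
  convex_pos g.
Proof.
move=> fg cf x y z x0 xy yz.
have y0 := lt_le_trans x0 xy; have z0 := lt_le_trans y0 yz.
by rewrite -!fg//; exact: cf.
Qed.

Lemma convex_posD f g : convex_pos f -> convex_pos g -> convex_pos (fun x => f x + g x).
Proof.
by move=> cf cg x y z x0 xy yz; have := cf _ _ _ x0 xy yz; have := cg _ _ _ x0 xy yz;
  lra.
Qed.

(** The bound with eta y from the left and from the right of the middle point y
    turns eta into a subgradient. *)
Lemma convex_pos_subgradient g (eta : R -> R) :
  (forall x y, 0 < x -> x < y ->
    (y - x) * eta x <= g y - g x /\ g y - g x <= (y - x) * eta y) -> convex_pos g.
Proof.
move=> H x y z x0; rewrite le_eqVlt => /predU1P[<-|xy].
  by move=> yz; lra.
rewrite le_eqVlt => /predU1P[<-|yz]; first by lra.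
have [_ H1] := H _ _ x0 xy.
have [H2 _] := H _ _ (lt_trans x0 xy) yz.
have yz0 : 0 <= z - y by rewrite subr_ge0 ltW.
have xy0 : 0 <= y - x by rewrite subr_ge0 ltW.
have := ler_wpM2l yz0 H1.
have := ler_wpM2l xy0 H2.
lra.
Qed.

Lemma conv_lmodE (t : {i01 R}) (a b : convex_lmodType R^o) :
  conv t a b = t%:num * (a : R) + (1 - t%:num) * (b : R) :> R.
Proof. by []. Qed.

Lemma convex_functionP g :
  convex_function (E := R^o) `]0%R, +oo[%classic g <-> convex_pos g.
Proof.
split=> [cg x y z x0 xy yz|cg t x y].
  have [xz|xz] := eqVneq x z.
    have -> : y = x by apply/eqP; rewrite eq_le xy xz yz.
    by rewrite xz; lra.
  have xz' : 0 < z - x by rewrite subr_gt0 lt_neqAle xz (le_trans xy).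
  have z0 : 0 < z by rewrite (lt_le_trans x0)// (le_trans xy).
  have t0 : 0 <= (z - y) / (z - x) by rewrite divr_ge0 ?(ltW xz')// subr_ge0.
  have t1 : (z - y) / (z - x) <= 1.
    by rewrite ler_pdivrMr// mul1r lerD2l lerN2.
  have := cg (Itv01 t0 t1) x z.
  rewrite !inE/= !in_itv/= !andbT => /(_ x0 z0).
  rewrite convRE conv_lmodE /= /unstable.onem.
  have -> : (z - y) / (z - x) * x + (1 - (z - y) / (z - x)) * z = y.
    by field; rewrite gt_eqF.
  rewrite -(ler_pM2l xz').
  set A := g y; set B := g x; set C := g z.
  have -> : (z - x) * ((z - y) / (z - x) * B + (1 - (z - y) / (z - x)) * C) =
    (z - y) * B + (y - x) * C.
    by field; rewrite gt_eqF.
  by [].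
rewrite !inE/= !in_itv/= !andbT; move: x y => /= x y x0 y0.
rewrite convRE conv_lmodE /unstable.onem.
have : 0 <= (t%:num : R) by exact: ge0.
have : (t%:num : R) <= 1 by exact: le1.
move: (t%:num : R) => s /= s1 s0.
wlog xy : x y x0 y0 s s0 s1 / x <= y.
  move=> W; have [xy|/ltW yx] := leP x y; first exact: W.
  have := W y x y0 x0 (1 - s).
  rewrite subr_ge0 => /(_ s1).
  have -> : 1 - s <= 1 by lra.
  move=> /(_ isT yx).
  rewrite opprB addrCA subrr addr0 [X in g X]addrC => /le_trans; apply.
  by rewrite addrC.
have [<-|xy'] := eqVneq x y.
  by rewrite -!mulrDl addrCA subrr addr0 !mul1r.
have yx : 0 < y - x by rewrite subr_gt0 lt_neqAle xy'.
have := cg x (s * x + (1 - s) * y) y x0.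
have -> : x <= s * x + (1 - s) * y by nra.
have -> : s * x + (1 - s) * y <= y by nra.
move=> /(_ isT isT).
have -> : y - (s * x + (1 - s) * y) = (y - x) * s by ring.
have -> : s * x + (1 - s) * y - x = (y - x) * (1 - s) by ring.
by rewrite -!mulrA -mulrDr ler_pM2l.
Qed.

End convexity.

(** * Right slopes and telescoping errors *)

Section right_slope.
Context {R : realType}.
Implicit Types (f g h : R -> R).

(** The right derivative of a convex function.  Difference quotients decrease
    with the increment, so it is their infimum: no limit has to be taken. *)
Definition right_slope g (x : R) : R :=
  inf [set (g y - g x) / (y - x) | y in [set y | x < y]].

Lemma right_slope_le g (x y : R) : convex_pos g -> 0 < x -> x < y ->
  right_slope g x <= (g y - g x) / (y - x).
Proof.
move=> cg x0 xy; apply: ge_inf; last by exists y.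
exists ((g x - g (x / 2)) / (x - x / 2)) => _ [z /= xz <-].
have h0 : 0 < x - x / 2 by lra.
rewrite ler_pdivrMr// mulrAC ler_pdivlMr ?subr_gt0//.
have := cg (x / 2) x z; rewrite divr_gt0// => /(_ isT).
have -> : x / 2 <= x by lra.
move=> /(_ isT (ltW xz)); lra.
Qed.

Lemma right_slope_ge g (y z : R) : convex_pos g -> 0 < y -> 
  (forall x, y < x -> z <= (g x - g y) / (x - y)) -> z <= right_slope g y.
Proof.
move=> cg y0 H; apply: lb_le_inf.
  by exists ((g (y + 1) - g y) / (y + 1 - y)); exists (y + 1) => //=; rewrite ltrDl.
by move=> _ [x /= yx <-]; exact: H.
Qed.

Lemma right_slope_sandwich g (x y : R) : convex_pos g -> 0 < x -> x < y ->
  (y - x) * right_slope g x <= g y - g x /\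
  g y - g x <= (y - x) * right_slope g y.
Proof.
move=> cg x0 xy; have yx0 : 0 < y - x by rewrite subr_gt0.
split; first by rewrite mulrC -ler_pdivlMr//; exact: right_slope_le.
rewrite mulrC -ler_pdivrMr//; apply: right_slope_ge => //.
  exact: lt_trans xy.
move=> z yz.
rewrite ler_pdivrMr// mulrAC ler_pdivlMr ?subr_gt0//.
by have := cg _ _ _ x0 (ltW xy) (ltW yz); lra.
Qed.

Lemma right_slope_nd g (x y : R) : convex_pos g -> 0 < x -> x <= y ->
  right_slope g x <= right_slope g y.
Proof.
move=> cg x0; rewrite le_eqVlt => /predU1P[->//|xy].
have [H1 H2] := right_slope_sandwich cg x0 xy.
by rewrite -(@ler_pM2l _ (y - x)) ?subr_gt0//; exact: le_trans H2.
Qed.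

(** Right-continuity: for a fixed z > x the quotient from y to z is continuous
    in y and bounds the slope at y from above, and it can be chosen within e of
    the slope at x. *)
Lemma right_slope_rc g (x e : R) : convex_pos g -> 0 < x -> {for x, continuous g} ->
  0 < e -> \forall y \near x, x < y -> right_slope g y <= right_slope g x + e.
Proof.
move=> cg x0 ctg e0.
have /inf_adherent : has_inf [set (g y - g x) / (y - x) | y in [set y | x < y]].
  split; first by exists ((g (x + 1) - g x) / (x + 1 - x)); exists (x + 1) => //=;
    rewrite ltrDl.
  exists (right_slope g x) => _ [y /= xy <-]; exact: right_slope_le.
move=> /(_ _ e0)[_ [z /= xz <-] Hz].
have Hc : (g z - g y) / (z - y) @[y --> x] --> (g z - g x) / (z - x).
  apply: cvgM; first by apply: cvgB => //; exact: cvg_cst.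
  apply: cvgV; first by rewrite subr_eq0 gt_eqF.
  by apply: cvgB; [exact: cvg_cst|exact: cvg_id].
near=> y => xy.
have yz : y < z by near: y; exact: lt_nbhsl.
apply: (@le_trans _ _ ((g z - g y) / (z - y))).
  by apply: right_slope_le => //; exact: lt_trans xy.
apply/ltW; near: y.
exact: (cvgr_lt ((g z - g x) / (z - x))).
Unshelve. all: by end_near. Qed.

(** The error rho x - rho y telescopes: over n equal pieces of [x, y] the errors
    add up to (y - x) / n * (rho x - rho y), which tends to 0. *)
Lemma subdivision_lower F (eta rho : R -> R) :
  (forall x y, 0 < x -> x <= y -> eta x <= eta y) ->
  (forall x y, 0 < x -> x < y ->
     (y - x) * (eta x - (rho x - rho y)) <= F y - F x) ->
  forall x y, 0 < x -> x < y -> (y - x) * eta x <= F y - F x.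
Proof.
move=> Heta HF x y x0 xy.
have yx : 0 < y - x by rewrite subr_gt0.
have key (n : nat) : (y - x) * eta x <=
  F y - F x + n.+1%:R^-1 * ((y - x) * (rho x - rho y)).
  pose d := (y - x) / n.+1%:R.
  have d0 : 0 < d by rewrite divr_gt0.
  pose p (i : nat) := x + d * i%:R.
  have pS i : p i.+1 = p i + d by rewrite /p -natr1; ring.
  have p0 i : x <= p i by rewrite lerDl mulr_ge0// ltW.
  have Hi (i : nat) : d * eta x <= F (p i.+1) - F (p i) + d * (rho (p i) - rho (p
    i.+1)).
    have := @HF (p i) (p i.+1) (lt_le_trans x0 (p0 i)).
    rewrite {1}pS ltrDl => /(_ d0).
    have -> : p i.+1 - p i = d by rewrite pS addrC addKr.
    have := ler_wpM2l (ltW d0) (Heta _ _ x0 (p0 i)).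
    lra.
  have pn : p n.+1 = y by rewrite /p /d; field.
  have Hs : forall m, m%:R * (d * eta x) <= F (p m) - F x + d * (rho x - rho (p m)).
    elim=> [|m ih]; first by rewrite mul0r /p mulr0 addr0 !subrr mulr0 addr0.
    by rewrite -natr1; have := Hi m; lra.
  have := Hs n.+1; rewrite pn.
  have -> : n.+1%:R * (d * eta x) = (y - x) * eta x by rewrite /d; field.
  by have -> : d * (rho x - rho y) =
    n.+1%:R^-1 * ((y - x) * (rho x - rho y)) by rewrite /d; field.
have cv : (F y - F x + n.+1%:R^-1 * ((y - x) * (rho x - rho y))) @[n --> \oo] --> F y -
  F x + 0 * ((y - x) * (rho x - rho y)).
  apply: cvgD; first exact: cvg_cst.
  by apply: cvgMl; exact: cvg_harmonic.
rewrite mul0r addr0 in cv.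
by apply: (cvgr_to_ge cv); near=> n; exact: key.
Unshelve. all: by end_near. Qed.

(** The same telescoping, with eta taken at the right end of each piece. *)
Lemma subdivision_upper F (eta rho : R -> R) :
  (forall x y, 0 < x -> x <= y -> eta x <= eta y) ->
  (forall x y, 0 < x -> x < y ->
     F y - F x <= (y - x) * (eta y + (rho x - rho y))) ->
  forall x y, 0 < x -> x < y -> F y - F x <= (y - x) * eta y.
Proof.
move=> Heta HF x y x0 xy.
have yx : 0 < y - x by rewrite subr_gt0.
have key (n : nat) : F y - F x - n.+1%:R^-1 * ((y - x) * (rho x - rho y)) <=
  (y - x) * eta y.
  pose d := (y - x) / n.+1%:R.
  have d0 : 0 < d by rewrite divr_gt0.
  pose p (i : nat) := x + d * i%:R.
  have pS i : p i.+1 = p i + d by rewrite /p -natr1; ring.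
  have p0 i : x <= p i by rewrite lerDl mulr_ge0// ltW.
  have pn : p n.+1 = y by rewrite /p /d; field.
  have py i : (i <= n.+1)%N -> p i <= y.
    by move=> ni; rewrite -pn lerD2l ler_pM2l// ler_nat.
  have Hi (i : nat) : (i <= n)%N ->
    F (p i.+1) - F (p i) - d * (rho (p i) - rho (p i.+1)) <= d * eta y.
    move=> ni.
    have := @HF (p i) (p i.+1) (lt_le_trans x0 (p0 i)).
    rewrite {1}pS ltrDl => /(_ d0).
    have -> : p i.+1 - p i = d by rewrite pS addrC addKr.
    have := ler_wpM2l (ltW d0) (Heta _ _ (lt_le_trans x0 (p0 i.+1)) (py i.+1 ni)).
    lra.
  have Hs : forall m, (m <= n.+1)%N ->
    F (p m) - F x - d * (rho x - rho (p m)) <= m%:R * (d * eta y).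
    elim=> [|m ih] mn; first by rewrite mul0r /p mulr0 addr0 !subrr mulr0 subrr.
    by rewrite -natr1; have := Hi m mn; have := ih (ltnW mn); lra.
  have := Hs n.+1 (leqnn _); rewrite pn.
  have -> : n.+1%:R * (d * eta y) = (y - x) * eta y by rewrite /d; field.
  by have -> : d * (rho x - rho y) =
    n.+1%:R^-1 * ((y - x) * (rho x - rho y)) by rewrite /d; field.
have cv : (F y - F x - n.+1%:R^-1 * ((y - x) * (rho x - rho y))) @[n --> \oo] --> F y -
  F x - 0 * ((y - x) * (rho x - rho y)).
  apply: cvgB; first exact: cvg_cst.
  by apply: cvgMl; exact: cvg_harmonic.
rewrite mul0r subr0 in cv.
by apply: (cvgr_to_le cv); near=> n; exact: key.
Unshelve. all: by end_near. Qed.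

End right_slope.

(** * Descent through the levels *)

Section descent.
Context {R : realType}.
Implicit Types (f g G v : R -> R).

(** Think of v = (-1)^n (x^n w)^(2n-2), G = - v' and r = 2n - 1.  Then x^r v has
    derivative x^(r-1) g, whence x^(r+1) G(x) = C - int s^r dg(s); slopes of g
    of at least e therefore make x^(r+1) (G + e / (r+1)) decrease.  The proof is
    this integration by parts for a g that need not be differentiable: g s is
    compared with the line of slope e through (x, g x), which gives an
    antiderivative Xi. *)
Lemma level_mono G g v (r : nat) (e x y : R) :
  (forall s, 0 < s -> g s = r%:R * v s - s * G s) ->
  (forall s : R, 0 < s -> is_derive s (1 : R) v (- G s)) ->
  0 < y -> y <= x ->
  (forall s, y <= s <= x -> e * (x - s) <= g x - g s) ->
  x ^+ r.+1 * (G x + e / r.+1%:R) <= y ^+ r.+1 * (G y + e / r.+1%:R).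
Proof.
move=> gE dv y0 yx He.
have x0 := lt_le_trans y0 yx.
pose Xi (s : R) := r%:R * (s ^+ r * v s) - (g x - e * x) * s ^+ r - e * r%:R / r.+1%:R
  * s ^+ r.+1.
have DX (s : R) n : is_derive s (1 : R) (fun s : R => s ^+ n) (n%:R * s ^+ n.-1).
  exact: is_derive_exprn.
pose Xi' (s : R) := r%:R * s ^+ r.-1 * (g s - g x + e * (x - s)).
have dXi (s : R) : 0 < s -> is_derive s (1 : R) (fun s : R => - Xi s) (- Xi' s).
  move=> s0; have Dv := dv s s0.
  apply: is_deriveN.
  have D1 : is_derive s (1 : R) (fun s : R => r%:R * (s ^+ r * v s))
      (r%:R * (s ^+ r * (- G s) + v s * (r%:R * s ^+ r.-1))).
    apply: is_deriveZ.
    exact: is_derive_eq (@is_deriveM _ _ _ _ _ _ _ _ (DX s r) Dv) _.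
  have D2 : is_derive s (1 : R) (fun s : R => (g x - e * x) * s ^+ r)
      ((g x - e * x) * (r%:R * s ^+ r.-1)) by exact: is_deriveZ.
  have D3 : is_derive s (1 : R) (fun s : R => e * r%:R / r.+1%:R * s ^+ r.+1)
      (e * r%:R / r.+1%:R * (r.+1%:R * s ^+ r)).
    by apply: is_deriveZ; exact: (DX s r.+1).
  apply: is_derive_eq (@is_deriveB _ _ _ _ _ _ _ _ _ (@is_deriveB _ _ _ _ _ _ _ _ _ D1
    D2) D3) _.
  rewrite /Xi' (gE s)//; case: (r) => [|r'] /=; first by rewrite !mul0r; ring.
  by rewrite exprS; field.
have : - Xi y <= - Xi x.
  apply: (@le_of_derive _ (fun s : R => - Xi s) (fun s : R => - Xi' s));
    first exact: yx.
    by move=> s /andP[ys _]; apply: dXi; exact: lt_le_trans ys.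
  move=> s sx; have /andP[ys sx'] := sx; have s0 := lt_le_trans y0 ys.
  rewrite oppr_ge0 /Xi' mulr_ge0_le0//.
    by rewrite mulr_ge0// exprn_ge0// ltW.
  have := He _ sx; lra.
rewrite lerN2 => XiE.
have -> : x ^+ r.+1 * (G x + e / r.+1%:R) = Xi x.
  have -> : Xi x = x ^+ r * (r%:R * v x) - (g x - e * x) * x ^+ r - e * r%:R / r.+1%:R
    * x ^+ r.+1.
    by rewrite /Xi; ring.
  have -> : r%:R * v x = g x + x * G x by rewrite gE//; ring.
  rewrite exprS -[in RHS]natr1 -[in LHS]natr1; field.
  by rewrite natr1.
apply: le_trans XiE _.
have -> : y ^+ r.+1 * (G y + e / r.+1%:R) = Xi y + y ^+ r * (g x - g y - e * (x - y)).
  have -> : Xi y = y ^+ r * (r%:R * v y) - (g x - e * x) * y ^+ r - e * r%:R / r.+1%:R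
    * y ^+ r.+1.
    by rewrite /Xi; ring.
  have -> : r%:R * v y = g y + y * G y by rewrite (gE y)//; ring.
  rewrite exprS -[in RHS]natr1 -[in LHS]natr1; field.
  by rewrite natr1.
rewrite lerDl mulr_ge0 ?exprn_ge0// ?(ltW y0)// subr_ge0.
by apply: He; rewrite lexx yx.
Qed.

(** Witnesses arbitrarily far out are all that monotonicity arguments consume. *)
Definition liminf_infty_ge0 G :=
  forall e X : R, 0 < e -> exists x, X <= x /\ - e <= G x.

Definition liminf_zero_ge0 G :=
  forall e d : R, 0 < e -> 0 < d -> exists x, [/\ 0 < x, x <= d & - e <= G x].

(** One step of the descent.  The behaviour at infinity makes g non-increasing,
    which is [level_mono] contradicted for a positive slope; then [level_mono]
    with slope 0, applied to - G, makes x^(r+1) G non-decreasing, and the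
    behaviour at 0 gives its sign. *)
Lemma level_nonneg G g v (r : nat) :
  (forall s, 0 < s -> g s = r%:R * v s - s * G s) ->
  (forall s : R, 0 < s -> is_derive s (1 : R) v (- G s)) ->
  convex_pos g -> liminf_infty_ge0 G ->
    liminf_zero_ge0 (fun x : R => x ^+ r.+1 * G x) ->
  forall x, 0 < x -> 0 <= G x.
Proof.
move=> gE dv cg Goo G0.
have gni x1 x2 : 0 < x1 -> x1 <= x2 -> g x2 <= g x1.
  move=> x10; rewrite le_eqVlt => /predU1P[->//|x12].
  rewrite leNgt; apply/negP => g12.
  have x20 := lt_trans x10 x12.
  pose e := (g x2 - g x1) / (x2 - x1).
  have e0 : 0 < e by rewrite divr_gt0 ?subr_gt0.
  pose C := x2 ^+ r.+1 * (G x2 + e / r.+1%:R).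
  have r0 : 0 < r.+1%:R :> R by [].
  (* G stays below - e / (r + 1) up to O(x^-(r+1)): half of that already
     contradicts the lower limit at infinity. *)
  pose e' := e / r.+1%:R / 2.
  have e'0 : 0 < e' by rewrite divr_gt0// divr_gt0.
  have [x [Xx Gx]] := Goo e' (Num.max x2 (Num.max 1 (C / e' + 1))) e'0.
  move: Xx; rewrite !ge_max => /and3P[x2x xge1 xC].
  have HC : x ^+ r.+1 * (G x + e / r.+1%:R) <= C.
    apply: (level_mono gE dv) => // s /andP[x2s sx].
    have [->|s2] := eqVneq s x2.
      have [->|xx2] := eqVneq x x2; first by rewrite !subrr mulr0.
      have x2x' : x2 < x by rewrite lt_neqAle eq_sym xx2.
      rewrite /e mulrAC ler_pdivrMr ?subr_gt0//.
      by have := cg _ _ _ x10 (ltW x12) x2x; lra.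
    have x2s' : x2 < s by rewrite lt_neqAle eq_sym s2.
    rewrite /e mulrAC ler_pdivrMr ?subr_gt0//.
    have H1 := cg _ _ _ x10 (ltW x12) x2s.
    have H2 := cg _ _ _ x20 x2s sx.
    have : (s - x2) * ((g x2 - g x1) * (x - s)) <= (s - x2) * ((g x - g s) * (x2 - x1)).
      have : (x - s) * ((s - x2) * (g x2 - g x1)) <=
        (x - s) * ((x2 - x1) * (g s - g x2)).
        by apply: ler_wpM2l; [rewrite subr_ge0|lra].
      have : (x2 - x1) * ((x - s) * (g s - g x2)) <=
        (x2 - x1) * ((s - x2) * (g x - g s)).
        by apply: ler_wpM2l; [rewrite subr_ge0 ltW|lra].
      by lra.
    by rewrite ler_pM2l// subr_gt0.
  have Ge : e' <= G x + e / r.+1%:R by rewrite [e / _]splitr -/e'; lra.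
  have xr : x <= x ^+ r.+1 by rewrite exprS ler_peMr ?exprn_ege1// (le_trans _ xge1).
  have : x * e' <= C.
    apply: le_trans HC; apply: ler_pM => //; first exact: le_trans xge1.
    exact: ltW.
  rewrite -ler_pdivlMr// => xC'.
  by have := le_trans xC xC'; lra.
have mono y x : 0 < y -> y <= x -> y ^+ r.+1 * G y <= x ^+ r.+1 * G x.
  move=> y0 yx.
  have : x ^+ r.+1 * (- G x + 0 / r.+1%:R) <= y ^+ r.+1 * (- G y + 0 / r.+1%:R).
    apply: (@level_mono (fun s : R => - G s) (fun s : R => - g s) (fun s : R =>
      - v s)) => //.
    - by move=> s s0; rewrite gE//; ring.
    - by move=> s s0; apply: is_deriveN; exact: dv.
    - by move=> s /andP[ys sx]; rewrite mul0r opprK addrC subr_ge0; apply: gni => //;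
      exact: lt_le_trans ys.
  by rewrite mul0r !addr0 !mulrN lerN2.
move=> x x0.
suff : 0 <= x ^+ r.+1 * G x by rewrite pmulr_rge0// exprn_gt0.
rewrite leNgt; apply/negP => xG.
have [y [y0 yx yG]] := G0 (- (x ^+ r.+1 * G x) / 2) x (ltac:(lra)) x0.
have := mono _ _ y0 yx; lra.
Qed.

(** The sign condition of level n + 1, (-1)^n (x^(n+1) f)^(2n+1); counting levels
    from 0 avoids truncated subtractions. *)
Definition st_level n f (x : R) : R := (-1) ^+ n * derive_Xn n.+1 n.*2.+1 f x.

(** A second antiderivative of [st_level n.+1]; the last condition defining a
    Stieltjes function is its convexity. *)
Definition st_convex n f (x : R) : R := (-1) ^+ n.+1 * derive_Xn n.+2 n.*2.+1 f x.

Lemma st_convex_pos n f : smooth n.+1.*2.+1 f ->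
  (forall x, 0 < x -> 0 <= st_level n.+1 f x) -> convex_pos (st_convex n f).
Proof.
move=> sf HG.
apply: (@convex_pos_of_jet _ (fun j x =>
  (-1) ^+ n.+1 * derive_Xn n.+2 (j + n.*2.+1) f x)).
  have /(jetZ ((-1) ^+ n.+1)) := derive_Xn_jet n.+2 sf.
  by move=> H j x j2 x0; apply: H => //; rewrite doubleS; lia.
by move=> x x0; exact: HG.
Qed.

(** Convexity at the top level propagates downwards: non-negativity of level
    n + 1 is convexity at level n by [st_convex_pos], and [level_nonneg] turns
    it into non-negativity of level n. *)
Lemma descent N f : smooth N.*2.+1 f -> convex_pos (st_convex N f) ->
  (forall n, (n <= N)%N -> liminf_infty_ge0 (st_level n f)) ->
  (forall n, (n <= N)%N -> liminf_zero_ge0 (fun x : R =>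
    x ^+ n.+1.*2 * st_level n f x)) ->
  forall n x, (n <= N)%N -> 0 < x -> 0 <= st_level n f x.
Proof.
move=> sf cT Hoo H0.
have step n : (n <= N)%N -> convex_pos (st_convex n f) -> forall x, 0 < x ->
  0 <= st_level n f x.
  move=> nN cn; apply: (@level_nonneg _ (st_convex n f)
    (fun x : R => (-1) ^+ n.+1 * derive_Xn n.+1 n.*2 f x) n.*2.+1) => //.
  - move=> s s0; rewrite /st_convex /st_level (derive_XnS _ sf)//=;
    last by rewrite ltnS leq_double.
    by rewrite exprS; ring.
  - move=> s s0; rewrite /st_level.
    have := @derive_Xn_jet _ _ n.+1 _ sf n.*2 s.
    rewrite ltnS leq_double => /(_ nN s0) D.
    by apply: is_derive_eq (@is_deriveZ _ _ _ _ ((-1) ^+ n.+1) _ _ _ D) _;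
      rewrite /GRing.scale /= exprS; ring.
  - exact: Hoo.
  - exact: H0.
have down m : (m <= N)%N -> convex_pos (st_convex (N - m) f).
  elim: m => [|m ih] mN; first by rewrite subn0.
  have -> : (N - m.+1 = (N - m).-1)%N by rewrite subnS.
  have := ih (ltnW mN); have : (0 < N - m)%N by rewrite subn_gt0.
  have : (N - m <= N)%N by exact: leq_subr.
  case: (N - m)%N => [|n] nN; first by rewrite ltnn.
  move=> _ cn; rewrite -[n.+1.-1]/n.
  apply: st_convex_pos; last exact: step.
  by apply: jet_leq sf; rewrite ltnS leq_double.
move=> n x nN; apply: step => //.
by rewrite -(subKn nN); apply: down; exact: leq_subr.
Qed.

End descent.

(** * Homogeneous kernels and their derivatives *)

Section kernel.
Context {R : realType}.
Implicit Types (A B : {poly R}) (p x t : R).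

(** A kernel homogeneous of degree p.  Dividing by the larger of the two variables
    keeps the arguments of both polynomials in [0, 1]. *)
Definition kern p A B x t : R :=
  x `^ p * (if t <= x then A.[t / x] else B.[x / t]).

(** d/dx sends x^p A(t/x) to x^(p-1) (p A - X A')(t/x); [deriv_outer] is the
    counterpart for B(x/t).  Kernels are thus stable under differentiation. *)
Definition deriv_inner p A : {poly R} := p *: A - 'X * A^`().
Definition deriv_outer p B : {poly R} := p *: B + 'X * B^`().

Lemma is_deriveP f (t d : R) : is_derive t (1 : R) f d <->
  (h^-1 *: (f (h + t) - f t)) @[h --> 0^'] --> d.
Proof.
have E : (fun h : R => h^-1 *: (f (h + t) - f t)) =
         (fun h : R => h^-1 *: ((f \o shift t) (h *: (1 : R)) - f t)).
  by apply/funext => h /=; rewrite [h *: 1]mulr1.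
rewrite E; split=> [[df <-]//|H].
by split; [apply/cvg_ex; exists d|exact: cvg_lim].
Qed.

(** The difference quotient at t is, for each increment, one of the two
    quotients, and both have the limit d. *)
Lemma is_derive_glue f g (t d : R) : f t = g t ->
  is_derive t (1 : R) f d -> is_derive t (1 : R) g d ->
  is_derive t (1 : R) (fun x => if t <= x then f x else g x) d.
Proof.
move=> fg /is_deriveP df /is_deriveP dg; apply/is_deriveP.
apply/cvgrPdist_lt => e e0; rewrite lexx.
near=> h; case: ifPn => _; first by near: h; exact: (cvgrPdist_lt _ _).1 df e e0.
by rewrite fg; near: h; exact: (cvgrPdist_lt _ _).1 dg e e0.
Unshelve. all: by end_near. Qed.

Lemma powRB1 p x : 0 < x -> x `^ (p - 1) = x `^ p * x^-1.
Proof. by move=> x0; rewrite powRD ?powRN ?powRr1// ?(gt_eqF x0) ?implybT// ltW. Qed.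

Lemma powRMXn p x n : 0 < x -> x ^+ n * x `^ p = x `^ (p + n%:R).
Proof.
move=> x0; rewrite powRD ?(gt_eqF x0) ?implybT// powR_mulrn ?(ltW x0)//.
by rewrite mulrC.
Qed.

Lemma is_derive_kern_inner p A x t : 0 < x ->
  is_derive x (1 : R) (fun x => x `^ p * A.[t / x])
   (x `^ (p - 1) * (deriv_inner p A).[t / x]).
Proof.
move=> x0.
have D1 := is_derive1_powR p x0.
have D2 : is_derive x (1 : R) (fun x => t / x) (- (t / x ^+ 2)).
  have x_neq0 : id x != 0 :> R by rewrite gt_eqF.
  have := is_deriveV x_neq0 (is_derive_id x (1 : R)) => D.
  have := is_deriveZ t D => {}D.
  by apply: is_derive_eq D _; rewrite /GRing.scale /= mulr1 mulrN.
have D3 := @is_derive1_comp _ (horner A) (fun x =>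
  t / x) x _ _ (is_derive_poly A (t / x)) D2.
apply: is_derive_eq (is_deriveM D1 D3) _.
rewrite /deriv_inner !hornerE /GRing.scale /= powRB1//.
by field; rewrite gt_eqF.
Qed.

Lemma is_derive_kern_outer p B x t : 0 < x -> 0 < t ->
  is_derive x (1 : R) (fun x => x `^ p * B.[x / t])
   (x `^ (p - 1) * (deriv_outer p B).[x / t]).
Proof.
move=> x0 t0.
have D1 := is_derive1_powR p x0.
have D2 : is_derive x (1 : R) (fun x => x / t) (t^-1).
  have := is_deriveZ t^-1 (is_derive_id x (1 : R)) => D.
  rewrite (_ : (fun x => _) = t^-1 \*: id); last by apply/funext => y /=; rewrite mulrC.
  by apply: is_derive_eq D _; rewrite /GRing.scale /= mulr1.
have D3 := @is_derive1_comp _ (horner B) (fun x =>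
  x / t) x _ _ (is_derive_poly B (x / t)) D2.
apply: is_derive_eq (is_deriveM D1 D3) _.
rewrite /deriv_outer !hornerE /GRing.scale /= powRB1//.
by field; rewrite !gt_eqF.
Qed.

(** Differentiability on the diagonal needs the branches and their derivatives
    to agree at ratio 1; off the diagonal it is automatic. *)
Lemma is_derive_kern p A B x t : 0 < x -> 0 <= t ->
  A.[1] = B.[1] -> (deriv_inner p A).[1] = (deriv_outer p B).[1] ->
  is_derive x (1 : R) (fun x => kern p A B x t)
    (kern (p - 1) (deriv_inner p A) (deriv_outer p B) x t).
Proof.
move=> x0 t0 AB dAB; rewrite /kern.
case: (ltgtP t x) => [tx|xt|tx].
- apply: near_eq_is_derive (is_derive_kern_inner p A t x0).
  near=> y; have ty : t < y by near: y; exact: lt_nbhsr.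
  by rewrite (ltW ty).
- have t0' := lt_trans x0 xt.
  apply: near_eq_is_derive (is_derive_kern_outer p B x0 t0').
  near=> y; have yt : y < t by near: y; exact: lt_nbhsl.
  by rewrite leNgt yt.
- have t0' : 0 < t by rewrite tx.
  subst t.
  rewrite (_ : (fun y => _) = (fun y =>
    if x <= y then y `^ p * A.[x / y] else y `^ p * B.[y / x])); last first.
    by apply/funext => y; case: ifP.
  apply: is_derive_glue.
  + by rewrite divff ?gt_eqF// AB.
  + exact: is_derive_kern_inner.
  + by have := is_derive_kern_outer p B x0 x0; rewrite divff ?gt_eqF// -dAB.
Unshelve. all: by end_near. Qed.

End kernel.

(** * Smoothness across the diagonal and uniform bounds *)

Section kernel_pairs.
Context {R : realType}.
Implicit Types (A B E : {poly R}) (p x t : R).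

(** The polynomials of the i-th derivative of a kernel of degree p; the degree
    drops by one at each step. *)
Fixpoint inner_jet p i A :=
  if i is i'.+1 then deriv_inner (p - i'%:R) (inner_jet p i' A) else A.
Fixpoint outer_jet p i B :=
  if i is i'.+1 then deriv_outer (p - i'%:R) (outer_jet p i' B) else B.

Definition kern_jet p A B i := kern (p - i%:R) (inner_jet p i A) (outer_jet p i B).

Lemma coef_deriv_inner p A j : (deriv_inner p A)`_j = (p - j%:R) * A`_j.
Proof.
rewrite /deriv_inner coefB coefZ coefXM; case: j => [|j] /=; first by rewrite !subr0.
by rewrite coef_deriv mulrBl mulr_natl.
Qed.

Lemma coef_deriv_outer p B j : (deriv_outer p B)`_j = (p + j%:R) * B`_j.
Proof.
rewrite /deriv_outer coefD coefZ coefXM; case: j => [|j] /=; first by rewrite !addr0.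
by rewrite coef_deriv mulrDl mulr_natl.
Qed.

Lemma coef_inner_jet p i A j : (inner_jet p i A)`_j =
  \prod_(l < i) (p - l%:R - j%:R) * A`_j.
Proof.
elim: i => [|i ih] /=; first by rewrite big_ord0 mul1r.
by rewrite coef_deriv_inner ih big_ord_recr /=; ring.
Qed.

Lemma coef_outer_jet p i B j : (outer_jet p i B)`_j =
  \prod_(l < i) (p - l%:R + j%:R) * B`_j.
Proof.
elim: i => [|i ih] /=; first by rewrite big_ord0 mul1r.
by rewrite coef_deriv_outer ih big_ord_recr /=; ring.
Qed.

(** X^K (A(X) - B(1/X)).  The order of its zero at 1 measures how many
    derivatives of the kernel match across the diagonal. *)
Definition gap K A B : {poly R} := 'X^K * A - \poly_(j < K.+1) B`_(K - j).

(** Conjugating p - X d/dX by X^K shifts p to p + K. *)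
Lemma gap_step K p A B : (size B <= K.+1)%N ->
  gap K (deriv_inner p A) (deriv_outer p B) =
    (p + K%:R) *: gap K A B - 'X * (gap K A B)^`().
Proof.
move=> sB; apply/polyP => j.
rewrite -[RHS]/((deriv_inner (p + K%:R) (gap K A B))`_j) coef_deriv_inner /gap !coefB
  !coefXnM !coef_poly.
have [jK|Kj] := ltnP j K.
  rewrite ltnS (ltnW jK) !sub0r coef_deriv_outer natrB ?(ltnW jK)//; ring.
rewrite coef_deriv_inner natrB//.
case: ltnP => jK; last by ring.
have -> : j = K by apply/eqP; rewrite eqn_leq -ltnS jK Kj.
by rewrite subnn coef_deriv_outer /=; ring.
Qed.

(** Differentiation lowers the order of a zero by at most one. *)
Lemma dvdp_step (m : nat) (c : R) E : (('X - 1%:P) ^+ m.+1 %| E)%R ->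
  (('X - 1%:P) ^+ m %| c *: E - 'X * E^`())%R.
Proof.
move=> /dvdpP [q ->].
rewrite derivM deriv_exp derivXsubC /= mul1r -mul_polyC.
apply/dvdpP; exists (c%:P * q * ('X - 1%:P) - 'X * q^`() * ('X - 1%:P) - 'X * q *
  m.+1%:R).
by rewrite exprS -mulr_natl; ring.
Qed.

Lemma size_deriv_outer K p B : (size B <= K)%N -> (size (deriv_outer p B) <= K)%N.
Proof.
by move=> /leq_sizeP sB; apply/leq_sizeP => j Kj; rewrite coef_deriv_outer sB// mulr0.
Qed.

Lemma gap_jet K p A B m i : (size B <= K.+1)%N ->
  (('X - 1%:P) ^+ (m + i) %| gap K A B)%R ->
  (size (outer_jet p i B) <= K.+1)%N /\ (('X - 1%:P) ^+ m %| gap K (inner_jet p i A)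
    (outer_jet p i B))%R.
Proof.
move=> sB; elim: i m => [|i ih] m; first by rewrite addn0.
rewrite addnS -addSn => /ih[sB' H]; split; first exact: size_deriv_outer.
by rewrite /= gap_step//; exact: dvdp_step.
Qed.

Lemma gap_dvd1 K m A B : (size B <= K.+1)%N ->
  (('X - 1%:P) ^+ m.+1 %| gap K A B)%R -> A.[1] = B.[1].
Proof.
move=> sB H; have : (('X - 1%:P) %| gap K A B)%R.
  by apply: dvdp_trans H; rewrite exprS dvdp_mulr.
rewrite dvdp_XsubCl rootE /gap hornerD hornerN hornerM hornerXn expr1n mul1r.
rewrite subr_eq0 => /eqP ->.
rewrite horner_poly (horner_coef_wide _ sB).
rewrite (reindex_inj rev_ord_inj) /=; apply: eq_bigr => i _.
by rewrite subSS subKn ?expr1n// -ltnS.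
Qed.

Lemma kern_is_jet K (A B : {poly R}) M p : (size B <= K.+1)%N ->
  (('X - 1%:P) ^+ M.+1 %| gap K A B)%R ->
  forall t i x, 0 <= t -> (i < M)%N -> 0 < x ->
   is_derive x (1 : R) (fun x => kern_jet p A B i x t) (kern_jet p A B i.+1 x t).
Proof.
move=> sB H t i x t0 iM x0.
have Hi j : (j <= M)%N -> (inner_jet p j A).[1] = (outer_jet p j B).[1].
  move=> jM; have := @gap_jet K p A B (M - j).+1 j sB.
  by rewrite addSn subnK// => /(_ H)[s' /(gap_dvd1 s')].
have := @is_derive_kern _ (p - i%:R) (inner_jet p i A) (outer_jet p i B) x t x0 t0 (Hi
  _ (ltnW iM)) (Hi _ iM).
by rewrite /kern_jet -addrA -opprD natr1.
Qed.

Lemma poly_bound01 A : exists2 C : R, 0 <= C & forall u, 0 <= u <= 1 -> `|A.[u]| <= C.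
Proof.
exists (\sum_(i < size A) `|A`_i|); first by apply: sumr_ge0.
move=> u /andP[u0 u1]; rewrite horner_coef.
apply: le_trans (ler_norm_sum _ _ _) _; apply: ler_sum => i _.
by rewrite normrM ler_piMr// ger0_norm ?exprn_ge0// exprn_ile1.
Qed.

(** Up to a factor 2, x/(x + t) is min(1, x/t): the inner polynomial is bounded
    on [0, 1] and the outer one, having no constant term, is O(x/t). *)
Lemma kern_bound p A B : B`_0 = 0 -> exists2 C : R, 0 <= C &
  forall x t, 0 < x -> 0 <= t -> `|kern p A B x t| <= C * x `^ p * (x / (x + t)).
Proof.
move=> B0.
have [CA CA0 HA] := poly_bound01 A.
have [CB CB0 HB] := poly_bound01 (B %/ 'X).
have BE : B = B %/ 'X * 'X.
  by apply/eqP; rewrite -dvdp_eq -['X]subr0 dvdp_XsubCl rootE horner_coef0 B0.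
exists (2 * (CA + CB)); first by rewrite mulr_ge0// addr_ge0.
move=> x t x0 t0; have xt0 : 0 < x + t by rewrite ltr_wpDr.
rewrite /kern normrM ger0_norm ?powR_ge0// [X in _ <= X * _]mulrC -mulrA.
rewrite ler_wpM2l ?powR_ge0//.
case: (leP t x) => [tx|xt].
  have : 2^-1 <= x / (x + t) by rewrite ler_pdivlMr//; lra.
  have : `|A.[t / x]| <= CA.
    by apply: HA; rewrite divr_ge0 ?(ltW x0)//= ler_pdivrMr// mul1r.
  nra.
have t0' := lt_trans x0 xt.
have : x / t <= 2 * (x / (x + t)).
  by rewrite ler_pdivrMr// mulrA mulrAC ler_pdivlMr//; nra.
have : `|(B %/ 'X).[x / t]| <= CB.
  by apply: HB; rewrite divr_ge0 ?(ltW x0) ?(ltW t0')//= ler_pdivrMr// mul1r ltW.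
rewrite BE hornerM hornerX normrM [`|x / t|]ger0_norm ?divr_ge0 ?(ltW x0) ?(ltW t0')//.
have : 0 <= x / t by rewrite divr_ge0 ?(ltW x0) ?(ltW t0').
have := normr_ge0 (B %/ 'X).[x / t].
rewrite mulpK ?polyX_eq0//.
move=> h1 h2 h3 h4.
apply: (@le_trans _ _ (CB * (2 * (x / (x + t))))); first exact: ler_pM.
by rewrite mulrCA -[X in _ <= X]mulrA ler_pM2l// ler_pM2r ?divr_gt0// lerDr.
Qed.

Lemma outer_jet_coef0 p i B : B`_0 = 0 -> (outer_jet p i B)`_0 = 0.
Proof. by rewrite coef_outer_jet => ->; rewrite mulr0. Qed.

Lemma measurable_kern p A B x : 0 < x ->
  measurable_fun [set: measurableTypeR R] (kern p A B x : measurableTypeR R -> R).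
Proof.
move=> x0; rewrite /kern.
apply: measurable_funM; first exact: measurable_cst.
rewrite (_ : (fun t => _) = (fun t =>
  if t <= x then A.[t / x] else B.[x / Num.max x t])); last first.
  apply/funext => t; case: leP => // xt.
have c1 : continuous (fun t : R => A.[t / x]).
  move=> t; apply: (@continuous_comp _ _ _ (fun t => t / x) (horner A)).
    by apply: cvgMl; exact: cvg_id.
  exact: continuous_horner.
have c2 : continuous (fun t : R => B.[x / Num.max x t]).
  move=> t; apply: (@continuous_comp _ _ _ (fun t => x / Num.max x t) (horner B)).
    apply: cvgMr; apply: cvgV; first by rewrite gt_eqF// lt_max x0.
    by apply: continuous_max; [exact: cvg_cst|exact: cvg_id].
  exact: continuous_horner.
apply: measurable_fun_ifT.
- by apply: measurable_fun_ler.
- exact: continuous_measurable_fun.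
- exact: continuous_measurable_fun.
Qed.

End kernel_pairs.

(** * The polynomials of the kernel Phi *)

Section stieltjes_kernel.
Context {R : realType}.
Implicit Types (p x t : R).

(** P_K; [outer_poly] is its opposite without constant term. *)
Definition inner_poly K : {poly R} :=
  \poly_(j < K.+1) ('C(2 * K, j + K)%:R * (-1) ^+ j).
Definition outer_poly K : {poly R} := ((inner_poly K)`_0)%:P - inner_poly K.

Lemma coef_inner_poly K j : (inner_poly K)`_j = 'C(2 * K, j + K)%:R * (-1) ^+ j.
Proof.
rewrite coef_poly; case: ltnP => // Kj; rewrite bin_small ?mul0r//.
by rewrite mul2n -addnn ltn_add2r.
Qed.

Lemma coef_outer_poly K j : (outer_poly K)`_j =
  if j == 0%N then 0 else - ('C(2 * K, j + K)%:R * (-1) ^+ j).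
Proof. by rewrite coefB coefC -coef_inner_poly; case: j => [|j] /=;
  rewrite ?subrr ?sub0r. Qed.

Lemma size_outer_poly K : (size (outer_poly K) <= K.+1)%N.
Proof.
apply/leq_sizeP => j Kj; rewrite coef_outer_poly; case: eqP => // _.
by rewrite bin_small ?mul0r ?oppr0// mul2n -addnn ltn_add2r.
Qed.

Lemma stieltjes_PE K x : stieltjes_P K x = (inner_poly K).[x].
Proof.
rewrite /stieltjes_P horner_poly big_mkord; apply: eq_bigr => i _.
by rewrite -mulrA -exprMn mulN1r.
Qed.

Lemma stieltjes_PhiE K x t : 0 < x ->
  stieltjes_Phi K x t = kern (-1) (inner_poly K) (outer_poly K) x t.
Proof.
move=> x0; rewrite /stieltjes_Phi /kern /stieltjes_Phat !stieltjes_PE.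
rewrite powRN powRr1 ?(ltW x0)//; congr (_ * _).
rewrite !indicE; case: (leP t x) => tx.
  rewrite mem_set// memNset /=; last by rewrite ltNge tx.
  by rewrite mulr1 mulr0 subr0.
rewrite memNset /=; last by rewrite leNgt tx.
by rewrite mem_set// mulr0 mulr1 sub0r /outer_poly !hornerE horner_coef0 opprB.
Qed.

(** Reading the coefficients of P_K upwards from degree K and those of the
    outer branch downwards gives all binomial coefficients of order 2K. *)
Lemma gap_poly K : gap K (inner_poly K) (outer_poly K) =
  (-1) ^+ K *: ('X - 1%:P) ^+ (2 * K).
Proof.
apply/polyP => i; rewrite coefZ /gap coefB coefXnM coef_inner_poly [X in _ -
  X]coef_poly coef_outer_poly.
have -> : (('X - 1%:P) ^+ (2 * K))`_i = (-1) ^+ i * 'C(2 * K, i)%:R :> R.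
  have -> : ('X - 1%:P) ^+ (2 * K) = (1 - 'X) ^+ (2 * K) :> {poly R}.
    by rewrite !exprM -[in LHS]opprB sqrrN.
  rewrite exprBn.
  rewrite (eq_bigr (fun l : 'I_(2 * K).+1 => ((-1) ^+ l * 'C(2 * K, l)%:R) *: 'X^l)).
    rewrite -(poly_def (2 * K).+1 (fun l => (-1) ^+ l * 'C(2 * K, l)%:R)).
    by rewrite coef_poly; case: ltnP => // Ki; rewrite bin_small ?mulr0.
  move=> l _; rewrite expr1n mulr1 -mul_polyC polyCM rmorphXn /= polyCN polyC1.
  by rewrite polyC_natr -mulr_natr; ring.
have sg (a b : nat) : odd a = odd b -> (-1) ^+ a = (-1) ^+ b :> R.
  by move=> E; rewrite -signr_odd E signr_odd.
case: (ltngtP i K) => iK.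
- rewrite ltnS (ltnW iK) sub0r subn_eq0 leqNgt iK /= opprK.
  rewrite mulrC mulrA -exprD; congr (_ * _).
    by apply: sg; rewrite oddB ?(ltnW iK)// oddD.
  rewrite -bin_sub; last by lia.
  by congr ('C(_, _)%:R); lia.
- rewrite ltnS leqNgt iK /= subr0 subnK ?(ltnW iK)// mulrC mulrA -exprD.
  by congr (_ * _); apply: sg; rewrite oddB ?(ltnW iK)// oddD addbC.
- rewrite iK ltnSn subnn eqxx subr0 add0n expr0 mulr1 mulrA -exprD.
  by rewrite addnn -signr_odd odd_double mul1r.
Qed.

Lemma prod_ffact (m i : nat) : \prod_(l < i) (m%:R - l%:R) = (m ^_ i)%:R :> R.
Proof.
elim: i => [|i ih]; first by rewrite big_ord0.
rewrite big_ord_recr /= ih ffactnSr natrM.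
have [im|mi] := leqP i m; first by rewrite natrB.
by rewrite ffact_small// !mul0r.
Qed.

(** After 2K - 1 derivatives of x^(K+1) Phi_K only the outer monomials of
    degrees K - 1 and K survive, except that for K = 1 the constant term of the
    inner polynomial replaces the former. *)
Lemma kern_jet_top N x t : 0 < x -> 0 <= t ->
  (-1) ^+ N.+1 * kern_jet N.+1%:R (inner_poly N.+1) (outer_poly N.+1) N.*2.+1 x t =
  - (2 * (N == 0%N)%:R) + (N.+1.*2)`!%:R * t^-1 ^+ N.+1 * Num.max (t - x) 0.
Proof.
move=> x0 t0; rewrite /kern_jet /kern.
case: (leP t x) => tx.
  rewrite max_r ?subr_le0// mulr0 addr0.
  have -> : inner_jet N.+1%:R N.*2.+1 (inner_poly N.+1) = (2 * (N == 0%N)%:R)%:P.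
    apply/polyP => j; rewrite coef_inner_jet coefC coef_inner_poly.
    have [jN|Nj] := leqP j N.+1; last first.
      rewrite bin_small; last by lia.
      by rewrite mul0r mulr0; case: j Nj.
    have -> : \prod_(l < N.*2.+1) (N.+1%:R - l%:R - j%:R) =
      ((N.+1 - j) ^_ N.*2.+1)%:R :> R.
      by rewrite -prod_ffact; apply: eq_bigr => l _; rewrite natrB//; ring.
    case: N jN {x0 t0 tx} => [|N] jN /=; last first.
      by rewrite ffact_small ?mul0r ?mulr0 ?if_same//; lia.
    case: j jN => [|j] jN /=.
      by rewrite subn0 ffactn1 expr0 !mulr1 mul1r.
    by rewrite subSS sub0n ffact_small// mul0r.
  rewrite hornerC; case: (N) => [|n] /=; last by rewrite mulr0 oppr0 !mulr0.
  by rewrite subrr powRr0 expr1; ring.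
have t0' := lt_trans x0 tx.
rewrite max_l ?subr_ge0 ?(ltW tx)//.
set F : R := (N.+1.*2)`!%:R.
have FE : F = (N.+1.*2)`!%:R by [].
clearbody F.
have -> : outer_jet N.+1%:R N.*2.+1 (outer_poly N.+1) =
  ((-1) ^+ N * F)%:P * ('X^(N.+1) - ((N != 0%N)%:R)%:P * 'X^N).
  apply/polyP => j; rewrite coef_outer_jet coef_outer_poly coefCM coefB coefCM !coefXn.
  have -> : \prod_(l < N.*2.+1) (N.+1%:R - l%:R + j%:R) =
    ((N.+1 + j) ^_ N.*2.+1)%:R :> R.
    by rewrite -prod_ffact; apply: eq_bigr => l _; rewrite natrD; ring.
  have [jN|Nj] := ltnP j N.
    rewrite ffact_small; last by lia.
    rewrite mul0r.
    rewrite (ltn_eqF (ltnW jN : (j < N.+1)%N)) (ltn_eqF jN).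
    rewrite mulr0.
    rewrite subr0.
    by rewrite mulr0.
  have [->|jN] := eqVneq j N.
    rewrite (ltn_eqF (ltnSn N)).
    case: (N) FE => [|n] FE /=; first by rewrite !mul0r subr0 !mulr0.
    rewrite (_ : (n.+2 + n.+1 = n.+1.*2.+1)%N); last by lia.
    rewrite (_ : (2 * n.+2 = n.+2.*2)%N); last by lia.
    rewrite (_ : (n.+1 + n.+2 = n.+1.*2.+1)%N); last by lia.
    rewrite ffactnn (_ : (n.+2.*2 = n.+1.*2.+2)%N); last by lia.
    rewrite binSn FE (_ : n.+2.*2 = (n.+1.*2.+1).+1)%N; last by lia.
    by rewrite [(n.+1.*2.+2)`!]factS natrM; move: ((n.+1.*2.+1)`!%:R : R) => c; ring.
  have [->|jN'] := eqVneq j N.+1.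
    have := @ffact_fact (N.+1 + N.+1) N.*2.+1.
    rewrite (_ : (N.+1 + N.+1 - N.*2.+1 = 1)%N); last by lia.
    rewrite muln1 => ->; last by lia.
    rewrite addnn -FE.
    by rewrite mul2n binn /= mulr0 subr0 exprS; ring.
  rewrite bin_small; last by lia.
  rewrite mul0r (_ : j == 0%N = false); last by lia.
  by rewrite oppr0 mulr0 mulr0 subr0 mulr0.
rewrite !hornerE /=.
have -> : x `^ (N.+1%:R - N.*2.+1%:R) = x ^- N.
  rewrite -powR_mulrn ?(ltW x0)// -powRN; congr (_ `^ _).
  by rewrite -addnn -natr1 -[(N + N).+1%:R]natr1 natrD; ring.
have xN0 : x != 0 by rewrite gt_eqF.
have tN0 : t != 0 by rewrite gt_eqF.
case: (N) FE => [|n] FE /=.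
  have -> : F = 2 by rewrite FE.
  by rewrite !expr1 !expr0 invr1; field.
rewrite exprMn [(x * t^-1) ^+ n.+1]exprMn !exprVn.
have sgn : (-1) ^+ n.+2 * (-1) ^+ n.+1 = -1 :> R.
  by rewrite exprS -mulrA -expr2 sqrr_sign mulr1.
rewrite [X in X * F](_ : _ = (-1) ^+ n.+2 * (-1) ^+ n.+1 / x ^+ n.+1); last by ring.
rewrite sgn !exprS.
have xn : x ^+ n != 0 by rewrite expf_neq0.
have tn : t ^+ n != 0 by rewrite expf_neq0.
by field; rewrite ?xn ?tn ?xN0 ?tN0.
Qed.

End stieltjes_kernel.

(** * Differentiation of potentials *)

Section potential.
Context {R : realType} (mu : {measure set (measurableTypeR R) -> \bar R})
  (D : set (measurableTypeR R)).
Hypothesis mD : measurable D.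
Hypothesis D0 : forall t, D t -> 0 <= t.
Hypothesis intD : mu.-integrable D (fun t => ((1 + t)^-1)%:E).
Implicit Types (A B : {poly R}) (p x t : R).

Lemma integrable_bounded (h : measurableTypeR R ->
  R) C : measurable_fun [set: measurableTypeR R] h ->
  (forall t, D t -> `|h t| <= C * (1 + t)^-1) -> mu.-integrable D (EFin \o h).
Proof.
move=> mh hC.
have iC : mu.-integrable D (fun t => (C%:E * ((1 + t)^-1)%:E)%E) by exact: integrableZl.
apply: le_integrable iC => //.
  by apply/measurable_EFinP; exact: measurable_funTS.
move=> t Dt; rewrite /= lee_fin.
by apply: le_trans (hC _ Dt) _; exact: ler_norm.
Qed.

(** The maximum makes the function continuous on the whole line, so that no
    measurability on a subset has to be discussed. *)
Lemma measurable_shiftV x : 0 < x ->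
  measurable_fun [set: measurableTypeR R] (fun t : measurableTypeR R =>
    (x + Num.max t 0)^-1).
Proof.
move=> x0; apply: continuous_measurable_fun => t.
apply: cvgV; first by rewrite gt_eqF// ltr_wpDr// le_max lexx orbT.
apply: cvgD; first exact: cvg_cst.
by apply: continuous_max; [exact: cvg_id|exact: cvg_cst].
Qed.

Lemma measurable_weight : measurable_fun D (fun t => ((1 + t)^-1)%:E).
Proof.
apply/measurable_EFinP.
apply: (@eq_measurable_fun _ _ _ _ _ (fun t : measurableTypeR R =>
  (1 + Num.max t 0)^-1)).
  by move=> t; rewrite inE => /D0 t0; rewrite max_l.
exact: measurable_funTS (measurable_shiftV ltr01).
Qed.

Lemma ratio_le x t : 0 < x -> 0 <= t -> x / (x + t) <= (1 + x) * (1 + t)^-1.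
Proof.
move=> x0 t0.
rewrite ler_pdivrMr ?ltr_wpDr// mulrAC ler_pdivlMr ?ltr_wpDr//.
nra.
Qed.

Lemma kern_integrable p A B x : B`_0 = 0 -> 0 < x ->
  mu.-integrable D (EFin \o kern p A B x).
Proof.
move=> B0 x0; have [C C0 HC] := kern_bound p A B0.
apply: (@integrable_bounded _ (C * x `^ p * (1 + x))).
  exact: measurable_kern.
move=> t /D0 t0; apply: le_trans (HC _ _ x0 t0) _.
by rewrite -[leRHS]mulrA ler_wpM2l ?mulr_ge0 ?powR_ge0// ratio_le.
Qed.

Definition potential p A B x : R := \int[mu]_(t in D) kern p A B x t.

(** Whatever the sign of q, the power is monotone, hence largest at an end of
    the interval. *)
Lemma powR_le_max u v x q : 0 < u -> u <= x -> x <= v -> x `^ q <= u `^ q + v `^ q.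
Proof.
move=> u0 ux xv; have x0 := lt_le_trans u0 ux; have v0 := lt_le_trans x0 xv.
have [q0|q0] := leP 0 q.
  by rewrite -[leLHS]add0r lerD ?powR_ge0// ge0_ler_powR// ?nnegrE ltW.
rewrite -[leLHS]addr0 lerD ?powR_ge0//.
rewrite -[q]opprK !(powRN _ (- q)) lef_pV2 ?posrE ?powR_gt0//.
by rewrite ge0_ler_powR// ?nnegrE ?oppr_ge0 ltW.
Qed.

(** One integrable function dominates the kernel for all y near x, as both
    theorems on integrals with a parameter demand. *)
Lemma kern_locally_dominated p A B x : B`_0 = 0 -> 0 < x ->
  exists G : measurableTypeR R -> R, [/\ forall t, 0 <= G t,
    mu.-integrable D (EFin \o G) &
    forall y t, x / 2 < y < x * 2 -> D t -> `|kern p A B y t| <= G t].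
Proof.
move=> B0 x0; have [C C0 HC] := kern_bound p A B0.
pose u := x / 2; pose v := x * 2.
have u0 : 0 < u by rewrite divr_gt0.
have v0 : 0 <= v by rewrite mulr_ge0// ltW.
pose G (t : measurableTypeR R) :=
  C * (u `^ p + v `^ p) * ((1 + v) * ((1 + Num.max t 0)^-1)).
have G0 t : 0 <= G t.
  have t0 : 0 <= Num.max t 0 by rewrite le_max lexx orbT.
  by rewrite /G mulr_ge0 ?mulr_ge0 ?invr_ge0 ?addr_ge0 ?powR_ge0.
exists G; split => //.
  apply: (@integrable_bounded _ (C * (u `^ p + v `^ p) * (1 + v))).
    rewrite /G; apply: measurable_funM; first exact: measurable_cst.
    apply: measurable_funM; first exact: measurable_cst.
    exact: measurable_shiftV.
  by move=> t /D0 t0; rewrite ger0_norm// /G (max_l t0) mulrA.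
move=> y t /andP[/ltW uy /ltW yv] /D0 t0.
have y0 : 0 < y := lt_le_trans u0 uy.
apply: le_trans (HC _ _ y0 t0) _.
rewrite /G (max_l t0); apply: ler_pM.
- by rewrite mulr_ge0 ?powR_ge0.
- by rewrite divr_ge0 ?addr_ge0 ?(ltW y0).
- by rewrite ler_wpM2l// powR_le_max.
- apply: le_trans (ratio_le y0 t0) _.
  by rewrite ler_wpM2r ?invr_ge0 ?addr_ge0// lerD2l.
Qed.

Lemma potential_is_derive p A B x : B`_0 = 0 -> 0 < x ->
  (forall (t y : R), 0 <= t -> 0 < y -> is_derive y (1 : R) (fun x => kern p A B x t)
    (kern (p - 1) (deriv_inner p A) (deriv_outer p B) y t)) ->
  is_derive x (1 : R) (potential p A B) (potential (p - 1) (deriv_inner p A)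
    (deriv_outer p B) x).
Proof.
move=> B0 x0 HK; apply/is_deriveP.
have B0' : (deriv_outer p B)`_0 = 0 by rewrite coef_deriv_outer B0 mulr0.
have [G [G0 iG HG]] := kern_locally_dominated (p - 1) (deriv_inner p A) B0' x0.
have xpos y : `]x / 2, x * 2[%classic y -> x / 2 < y < x * 2 /\ 0 < y.
  by rewrite /= in_itv/= => /andP[? ?]; split; [exact/andP|lra].
rewrite (_ : potential (p - 1) _ _ x =
    \int[mu]_(t in D) partial1of2 (fun x t => kern p A B x t) x t); last first.
  apply: eq_Rintegral => t; rewrite inE => /D0 t0.
  by rewrite /partial1of2 (is_derive1_val (HK t x t0 x0)).
apply: (@cvg_differentiation_under_integral _ _ _ mu
  (fun x t => kern p A B x t) D mD x (x / 2) (x * 2) _ _ _ G) => //.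
- by rewrite /= in_itv/=; apply/andP; split; lra.
- by move=> y /xpos[_ y0]; exact: kern_integrable.
- by move=> y t /xpos[_ y0] /D0 t0; have [] := HK t y t0 y0.
- move=> y t /xpos[yI y0] Dt.
  by rewrite /partial1of2 (is_derive1_val (HK t y (D0 Dt) y0)); exact: HG.
Qed.

End potential.

(** * Successive derivatives of the Stieltjes potential *)

Section potential_jets.
Context {R : realType} (mu : {measure set (measurableTypeR R) -> \bar R})
  (D : set (measurableTypeR R)).
Hypothesis mD : measurable D.
Hypothesis D0 : forall t, D t -> 0 <= t.
Hypothesis intD : mu.-integrable D (fun t => ((1 + t)^-1)%:E).
Implicit Types (A B : {poly R}) (p x t : R).

Lemma is_derive_continuous (f : R -> R) (x d : R) :
  is_derive x (1 : R) f d -> {for x, continuous f}.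
Proof. by case=> /derivable1_diffP/differentiable_continuous. Qed.

Lemma continuous_glue (f g : R -> R) t : f t = g t ->
  {for t, continuous f} -> {for t, continuous g} ->
  {for t, continuous (fun x => if t <= x then f x else g x)}.
Proof.
move=> fg cf cg; rewrite /prop_for /continuous_at lexx.
apply/cvgrPdist_lt => e e0.
near=> h; case: ifPn => _; first by near: h; exact: (cvgrPdist_lt _ _).1 cf e e0.
by rewrite fg; near: h; exact: (cvgrPdist_lt _ _).1 cg e e0.
Unshelve. all: by end_near. Qed.

Lemma near_eq_continuous (f g : R -> R) x : (\forall y \near x, f y = g y) ->
  {for x, continuous f} -> {for x, continuous g}.
Proof.
move=> fg; rewrite /prop_for /continuous_at -(nbhs_singleton fg) => cf.
by apply: cvg_trans cf; apply: near_eq_cvg.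
Qed.

(** Meant for the last derivative, whose branches agree on the diagonal although
    their slopes do not. *)
Lemma kern_continuous p A B x t : 0 < x -> 0 <= t -> A.[1] = B.[1] ->
  {for x, continuous (fun x => kern p A B x t)}.
Proof.
move=> x0 t0 AB; rewrite /kern.
case: (ltgtP t x) => [tx|xt|tx].
- apply: near_eq_continuous (is_derive_continuous (is_derive_kern_inner p A t x0)).
  near=> y; have ty : t < y by near: y; exact: lt_nbhsr.
  by rewrite (ltW ty).
- have t0' := lt_trans x0 xt.
  apply: near_eq_continuous (is_derive_continuous (is_derive_kern_outer p B x0 t0')).
  near=> y; have yt : y < t by near: y; exact: lt_nbhsl.
  by rewrite leNgt yt.
- subst t.
  rewrite (_ : (fun y => _) = (fun y =>
    if x <= y then y `^ p * A.[x / y] else y `^ p * B.[y / x])); last first.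
    by apply/funext => y; case: ifP.
  apply: continuous_glue.
  + by rewrite divff ?gt_eqF// AB.
  + exact: is_derive_continuous (is_derive_kern_inner p A x x0).
  + exact: is_derive_continuous (is_derive_kern_outer p B x0 x0).
Unshelve. all: by end_near. Qed.

Lemma potential_continuous p A B x : B`_0 = 0 -> 0 < x -> A.[1] = B.[1] ->
  {for x, continuous (potential mu D p A B)}.
Proof.
move=> B0 x0 AB.
have [G [G0 iG HG]] := kern_locally_dominated mD D0 intD p A B0 x0.
have xpos y : `]x / 2, x * 2[%classic y -> x / 2 < y < x * 2 /\ 0 < y.
  by rewrite /= in_itv/= => /andP[? ?]; split; [exact/andP|lra].
have xI : x \in (`]x / 2, x * 2[%classic : set R).
  by rewrite inE /= in_itv/=; apply/andP; split; lra.
apply: (@continuity_under_integral _ _ _ mu (fun x t => kern p A B x t) D mD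
  (x / 2) (x * 2) _ _ G iG) => //.
- by move=> y /xpos[_ y0]; exact: kern_integrable.
- apply: aeW => t /D0 t0 y; rewrite inE => /xpos[_ y0].
  exact: kern_continuous.
- by move=> y /xpos[yI _]; apply: aeW => t Dt; exact: HG.
Qed.

Definition potential_jet p A B i x := \int[mu]_(t in D) kern_jet p A B i x t.

Lemma potential_jetP K M p A B : B`_0 = 0 -> (size B <= K.+1)%N ->
  (('X - 1%:P) ^+ M.+1 %| gap K A B)%R -> jet M (potential_jet p A B).
Proof.
move=> B0 sB H j x jM x0; rewrite /potential_jet /kern_jet.
have -> : p - j.+1%:R = p - j%:R - 1 by rewrite -natr1; ring.
apply: potential_is_derive => //; first exact: outer_jet_coef0.
move=> t y t0 y0; have := kern_is_jet p sB H t0 jM y0.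
by rewrite /kern_jet -addrA -opprD natr1.
Qed.

Section stieltjes_potential.
Variable N : nat.
Let A : {poly R} := inner_poly N.+1.
Let B : {poly R} := outer_poly N.+1.

Lemma outer_poly_coef0 : B`_0 = 0. Proof. by rewrite coef_outer_poly. Qed.

Lemma gap_dvd M : (M <= N.*2.+2)%N -> (('X - 1%:P) ^+ M %| gap N.+1 A B)%R.
Proof.
move=> MN; rewrite gap_poly -mul_polyC dvdp_mull// dvdp_exp2l//.
by rewrite mul2n.
Qed.

Lemma st_potential_jet p : jet N.*2.+1 (potential_jet p A B).
Proof. exact: (potential_jetP _ outer_poly_coef0 (size_outer_poly _) (gap_dvd (leqnn
  _))). Qed.

Definition st_potential x := \int[mu]_(t in D) stieltjes_Phi N.+1 x t.

Lemma st_potentialE x : 0 < x -> st_potential x = potential_jet (-1) A B 0 x.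
Proof.
move=> x0; apply: eq_Rintegral => t _.
by rewrite stieltjes_PhiE// /kern_jet subr0.
Qed.

(** Multiplication by x^n raises the degree of the kernel from -1 to n - 1 and
    leaves its polynomials alone, so one computation serves all levels. *)
Lemma st_potentialMXn n x : 0 < x ->
  x ^+ n * st_potential x = potential_jet (n%:R - 1) A B 0 x.
Proof.
move=> x0; rewrite st_potentialE// -RintegralZl//; last first.
  by apply: kern_integrable => //; exact: outer_poly_coef0.
apply: eq_Rintegral => t _.
by rewrite /kern_jet !subr0 /kern mulrA powRMXn// addrC.
Qed.

Lemma smooth_st_potential : smooth N.*2.+1 st_potential.
Proof. exact: jet_of_derive1n st_potentialE (st_potential_jet (-1)). Qed.

Lemma derive_Xn_st_potential n j x : (j <= N.*2.+1)%N -> 0 < x ->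
  derive_Xn n j st_potential x = potential_jet (n%:R - 1) A B j x.
Proof. exact: (jet_derive1n (st_potentialMXn n) (st_potential_jet _)). Qed.

(** The gap vanishes to order 2K = 2N + 2 at 1, one more than the number 2N + 1
    of derivatives, which leaves continuity of the last one. *)
Lemma class_C_st_potential : class_C N.*2.+1 st_potential.
Proof.
split; first by move=> j x jN x0; have [] := smooth_st_potential jN x0.
move=> x x0.
apply: (@near_eq_continuous (potential_jet (-1) A B N.*2.+1)).
  near=> y; have y0 : 0 < y by near: y; exact: near_gt0.
  by rewrite -derive_X0 (derive_Xn_st_potential 0 (leqnn _) y0) sub0r.
have [sB dv] := @gap_jet _ N.+1 (-1) A B 1 N.*2.+1 (size_outer_poly _) (gap_dvd (leqnn
  _)).
apply: potential_continuous => //; first exact: outer_jet_coef0 outer_poly_coef0.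
exact: gap_dvd1 sB dv.
Unshelve. all: by end_near. Qed.

End stieltjes_potential.

End potential_jets.

(** * Boundary behaviour of potentials *)

Section potential_bounds.
Context {R : realType} (mu : {measure set (measurableTypeR R) -> \bar R})
  (D : set (measurableTypeR R)).
Hypothesis mD : measurable D.
Hypothesis D0 : forall t, D t -> 0 <= t.
Hypothesis intD : mu.-integrable D (fun t => ((1 + t)^-1)%:E).
Variable N : nat.
Implicit Types (A B : {poly R}) (p x t : R).

Local Notation I := (st_potential mu D N).

(** Up to powers of x, the integral of 1/(x + t) bounds every level of the
    potential; it vanishes as x tends to infinity. *)
Definition cauchy_potential x : R := \int[mu]_(t in D) (x + t)^-1.

Lemma invD_bound x t : 0 < x -> 0 <= t -> (x + t)^-1 <= (1 + x) / x * (1 + t)^-1.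
Proof.
move=> x0 t0; have := ratio_le x0 t0.
by rewrite -ler_pdivlMl// => /le_trans; apply; rewrite mulrA [x^-1 * _]mulrC.
Qed.

Lemma integrable_invD x : 0 < x -> mu.-integrable D (EFin \o (fun t => (x + t)^-1)).
Proof.
move=> x0.
have : mu.-integrable D (EFin \o (fun t : measurableTypeR R => (x + Num.max t 0)^-1)).
  apply: (@integrable_bounded _ _ _ mD intD _ ((1 + x) / x)).
    exact: measurable_shiftV.
  move=> t /D0 t0; rewrite (max_l t0) ger0_norm ?invr_ge0 ?addr_ge0 ?(ltW x0)//.
  exact: invD_bound.
by apply: eq_integrable => // t; rewrite inE => /D0 t0 /=; rewrite (max_l t0).
Qed.

Lemma cauchy_potential_ge0 x : 0 < x -> 0 <= cauchy_potential x.
Proof.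
move=> x0; apply: Rintegral_ge0 => t /D0 t0.
by rewrite invr_ge0 addr_ge0// ltW.
Qed.

Lemma cauchy_potential_le x : 0 < x ->
  x * cauchy_potential x <= (1 + x) * cauchy_potential 1.
Proof.
move=> x0; rewrite /cauchy_potential -!RintegralZl//; [|exact: integrable_invD..].
apply: le_Rintegral => //.
- have := @integrableZl _ _ _ mu D mD x _ (integrable_invD x0).
  by apply: eq_integrable => // t _; rewrite /= EFinM.
- have := @integrableZl _ _ _ mu D mD (1 + x) _ (integrable_invD ltr01).
  by apply: eq_integrable => // t _; rewrite /= EFinM.
- by move=> t /D0 t0; exact: ratio_le.
Qed.

(** Dominated convergence along the integers, with 1/(1 + t) as dominating
    function. *)
Lemma cauchy_potential_vanish (e X : R) : 0 < e ->
  exists x, [/\ X <= x, 1 <= x & cauchy_potential x <= e].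
Proof.
move=> e0.
have cv : (\int[mu]_(t in D) ((n.+1%:R + t)^-1)%:E)%E @[n --> \oo] --> (\int[mu]_(t in
  D) (cst 0 t))%E.
  apply: (@dominated_cvg _ _ _ mu D mD (fun n t =>
    ((n.+1%:R + t)^-1)%:E) (cst 0%E) (fun t => ((1 + t)^-1)%:E)) => //.
  - by move=> n; have /integrableP[] := @integrable_invD n.+1%:R ltac:(by []).
  - move=> t /D0 t0; apply: cvg_EFin; first exact: nearW.
    apply/cvgrPdist_le => d d0.
    near=> n; rewrite /= sub0r normrN ger0_norm ?invr_ge0 ?addr_ge0//.
    rewrite invf_ple ?posrE ?ltr_wpDr//.
    apply: (@le_trans _ _ n.+1%:R); last by rewrite lerDl.
    apply: (@le_trans _ _ n%:R); last by rewrite ler_nat.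
    by near: n; exact: nbhs_infty_ger.
  - move=> n t /D0 t0; rewrite lee_fin ger0_norm ?invr_ge0 ?addr_ge0//.
    by rewrite lef_pV2 ?posrE ?ltr_wpDr// lerD2r ler1n.
rewrite integral0 in cv.
have : \forall n \near \oo, cauchy_potential n.+1%:R <= e.
  have /fine_cvg /cvgr_le H := cv.
  by apply: H.
move=> Hn.
(* The shift by one keeps the chosen point at least 1. *)
have [n [nX Hne]] : exists n : nat, X <= n%:R /\ cauchy_potential n.+1%:R <= e.
  near \oo => n; exists n; split; last by near: n.
  by near: n; exact: nbhs_infty_ger.
exists n.+1%:R; split => //; last by rewrite ler1n.
by apply: le_trans nX _; rewrite ler_nat.
Unshelve. all: by end_near. Qed.

(** Level n + 1 of the potential has a kernel of degree - (n + 1), bounded by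
    x^-(n+1) x/(x + t). *)
Lemma st_level_potential_bound n : (n <= N)%N -> exists2 C, 0 <= C &
  forall x, 0 < x -> `|st_level n I x| <= C * x ^- n * cauchy_potential x.
Proof.
move=> nN.
have [C C0 HC] := @kern_bound R (n.+1%:R - 1 - n.*2.+1%:R)
  (inner_jet (n.+1%:R - 1) n.*2.+1 (inner_poly N.+1)) _
  (@outer_jet_coef0 R (n.+1%:R - 1) n.*2.+1 _ (outer_poly_coef0 N)).
exists C => // x x0.
have nN' : (n.*2.+1 <= N.*2.+1)%N by rewrite ltnS leq_double.
rewrite /st_level (derive_Xn_st_potential mD D0 intD _ nN' x0) normrM normrX normrN1
  expr1n mul1r.
have E : x `^ (n.+1%:R - 1 - n.*2.+1%:R) * x = x ^- n.
  rewrite -[X in _ * X](@powRr1 _ x) ?(ltW x0)// -powRD ?(gt_eqF x0) ?implybT//.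
  rewrite -powR_mulrn ?(ltW x0)// -powRN; congr (_ `^ _).
  by rewrite -addnn -!natr1 natrD; ring.
have ik : mu.-integrable D (EFin \o kern_jet (n.+1%:R - 1) (inner_poly N.+1)
  (outer_poly N.+1) n.*2.+1 x).
  by apply: kern_integrable => //; exact: outer_jet_coef0 (outer_poly_coef0 N).
apply: le_trans (le_normr_Rintegral mD ik) _.
rewrite /cauchy_potential -RintegralZl//; last exact: integrable_invD.
apply: le_Rintegral => //.
- have := integrable_norm ik; apply: eq_integrable => // t _ /=.
- have := @integrableZl _ _ _ mu D mD (C * x ^- n) _ (integrable_invD x0).
  by apply: eq_integrable => // t _; rewrite /= EFinM.
- move=> t /D0 t0; apply: le_trans (HC _ _ x0 t0) _.
  by rewrite -E !mulrA.
Qed.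

Lemma st_level_potential_infty n (e X : R) : (n <= N)%N -> 0 < e ->
  exists x, [/\ X <= x, 0 < x & `|st_level n I x| <= e].
Proof.
move=> nN e0; have [C C0 HC] := st_level_potential_bound nN.
have [x [Xx x1 Jx]] := @cauchy_potential_vanish (e / (C + 1)) X (divr_gt0 e0 (ltr_wpDl
  C0 ltr01)).
have x0 : 0 < x by exact: lt_le_trans x1.
exists x; split => //; apply: le_trans (HC _ x0) _.
have xn : x ^- n <= 1 by rewrite invf_le1 ?exprn_gt0// exprn_ege1.
have J0 := cauchy_potential_ge0 x0.
apply: (@le_trans _ _ (C * cauchy_potential x)).
  by rewrite ler_wpM2r// ler_piMr.
apply: (@le_trans _ _ ((C + 1) * cauchy_potential x));
  first by rewrite ler_wpM2r// lerDl.
by rewrite -ler_pdivlMl ?ltr_wpDl// mulrC.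
Qed.

Lemma st_level_potential_zero n (e d : R) : (n <= N)%N -> 0 < e -> 0 < d ->
  exists x, [/\ 0 < x, x <= d & `|x ^+ n.+1.*2 * st_level n I x| <= e].
Proof.
move=> nN e0 d0; have [C C0 HC] := st_level_potential_bound nN.
pose M := C * (2 * cauchy_potential 1) + 1.
have J1 := cauchy_potential_ge0 ltr01.
have M0 : 0 < M by rewrite ltr_wpDl// !mulr_ge0.
pose x := Num.min d (Num.min 1 (e / M)).
have x0 : 0 < x by rewrite !lt_min d0 ltr01 divr_gt0.
have x1 : x <= 1 by rewrite !ge_min lexx !orbT.
have xe : x <= e / M by rewrite !ge_min lexx !orbT.
exists x; split => //; first by rewrite ge_min lexx.
rewrite normrM ger0_norm ?exprn_ge0 ?(ltW x0)//.
apply: le_trans (ler_wpM2l _ (HC _ x0)) _; first by rewrite exprn_ge0// ltW.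
have -> : x ^+ n.+1.*2 * (C * x ^- n * cauchy_potential x) =
  C * x ^+ n * x * (x * cauchy_potential x).
  rewrite doubleS -addnn !exprS exprD; field.
  by rewrite expf_neq0// gt_eqF.
have Jx := cauchy_potential_le x0.
have xJ0 : 0 <= x * cauchy_potential x by rewrite mulr_ge0 ?cauchy_potential_ge0 ?(ltW
  x0).
have xn : x ^+ n <= 1 by rewrite exprn_ile1// ltW.
have xn0 : 0 <= x ^+ n by rewrite exprn_ge0// ltW.
apply: (@le_trans _ _ (C * x * (2 * cauchy_potential 1))).
  apply: ler_pM => //.
  - by rewrite !mulr_ge0// ltW.
  - by rewrite ler_wpM2r ?(ltW x0)// ler_piMr.
  - by apply: le_trans Jx _; rewrite ler_wpM2r// lerD2l.
apply: (@le_trans _ _ (x * M)).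
  by rewrite mulrAC mulrC ler_wpM2l ?(ltW x0)// /M lerDl.
by rewrite -ler_pdivlMr.
Qed.

Lemma st_level_DZ n f c x : (n <= N)%N -> smooth N.*2.+1 f -> 0 < x ->
  st_level n (fun y => f y + c * I y) x = st_level n f x + c * st_level n I x.
Proof.
move=> nN sf x0; rewrite /st_level (derive_XnDZ _ _ sf (@smooth_st_potential _ _ _ mD
  D0 intD N))//.
  by rewrite mulrDr mulrCA.
by rewrite ltnS leq_double.
Qed.

Lemma st_convex_DZ f c x : smooth N.*2.+1 f -> 0 < x ->
  st_convex N (fun y => f y + c * I y) x = st_convex N f x + c * st_convex N I x.
Proof.
move=> sf x0; rewrite /st_convex (derive_XnDZ _ _ sf (@smooth_st_potential _ _ _ mD D0
  intD N))//.
by rewrite mulrDr mulrCA.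
Qed.

(** A potential contributes nothing at either end, so f + c I inherits its
    boundary behaviour from f, whatever the sign of c. *)
Lemma descent_perturbed f c : smooth N.*2.+1 f ->
  (forall n x, (n <= N)%N -> 0 < x -> 0 <= st_level n f x) ->
  convex_pos (st_convex N (fun y => f y + c * I y)) ->
  forall n x, (n <= N)%N -> 0 < x -> 0 <= st_level n (fun y => f y + c * I y) x.
Proof.
move=> sf Gf cT.
have key u e : 0 < e -> `|u| <= e / (`|c| + 1) -> - e <= c * u.
  move=> e0; rewrite ler_pdivlMr ?ltr_wpDl// => H.
  have := ler_norm (- (c * u)); rewrite normrN normrM.
  have := normr_ge0 u; have := normr_ge0 c; nra.
have c1 e : 0 < e -> 0 < e / (`|c| + 1) by move=> e0; rewrite divr_gt0// ltr_wpDl.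
apply: descent.
- by apply: smoothDZ; [exact: sf|exact: (@smooth_st_potential _ _ _ mD D0 intD N)].
- exact: cT.
- move=> n nN e X e0.
  have [x [Xx x0 Hx]] := st_level_potential_infty X nN (c1 _ e0).
  exists x; split; first exact: Xx.
  rewrite st_level_DZ// -[leLHS]add0r; apply: lerD; first exact: Gf.
  exact: key e0 Hx.
- move=> n nN e d e0 d0.
  have [x [x0 xd Hx]] := st_level_potential_zero nN (c1 _ e0) d0.
  exists x; split; [exact: x0|exact: xd|].
  rewrite st_level_DZ// mulrDr [X in _ <= _ + X]mulrCA -[leLHS]add0r; apply: lerD;
    last exact: key e0 Hx.
  by apply: mulr_ge0; [rewrite exprn_ge0// ltW|exact: Gf].
Qed.

End potential_bounds.

(** * Convexity of potentials at the top level *)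

Section potential_top.
Context {R : realType} (mu : {measure set (measurableTypeR R) -> \bar R})
  (D : set (measurableTypeR R)).
Hypothesis mD : measurable D.
Hypothesis D0 : forall t, D t -> 0 <= t.
Hypothesis intD : mu.-integrable D (fun t => ((1 + t)^-1)%:E).
Variable N : nat.
Implicit Types (p x t : R).

Local Notation I := (st_potential mu D N).

(** The density (2K)! t^(-K) relating mu to the second derivative at the top
    level. *)
Definition top_weight t : R := (N.+1.*2)`!%:R * t^-1 ^+ N.+1.

Definition tail_weight x t : R := if x < t then top_weight t else 0.

(** Minus the slope at x of [st_convex] for the potential. *)
Definition tail_mass x := \int[mu]_(t in D) tail_weight x t.

Lemma top_weight_ge0 t : 0 <= t -> 0 <= top_weight t.
Proof. by move=> t0; rewrite /top_weight mulr_ge0// exprn_ge0// invr_ge0. Qed.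

Lemma measurable_tail_weight x : 0 < x ->
  measurable_fun [set: measurableTypeR R] (tail_weight x : measurableTypeR R -> R).
Proof.
move=> x0.
rewrite (_ : tail_weight x = (fun t =>
  if x < t then top_weight (Num.max x t) else 0)); last first.
  by apply/funext => t; rewrite /tail_weight; case: ltP => // /ltW xt; rewrite max_r.
apply: measurable_fun_ifT => //.
- exact: measurable_fun_ltr.
- apply: continuous_measurable_fun => t; rewrite /top_weight.
  apply: cvgMr; apply: (@continuous_comp _ _ _ (fun t => (Num.max x t)^-1) (fun s =>
    s ^+ N.+1)); last exact: exprn_continuous.
  apply: cvgV; first by rewrite gt_eqF// lt_max x0.
  by apply: continuous_max; [exact: cvg_cst|exact: cvg_id].
Qed.

Lemma integrable_tail_weight x : 0 < x -> mu.-integrable D (EFin \o tail_weight x).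
Proof.
move=> x0; apply: (@integrable_bounded _ _ _ mD intD _ ((N.+1.*2)`!%:R * x^-1 ^+ N *
  ((1 + x) / x))).
  exact: measurable_tail_weight.
move=> t /D0 t0; rewrite ger0_norm /tail_weight; last by case: ifP => // _;
  exact: top_weight_ge0.
have H0 : 0 <= (N.+1.*2)`!%:R * x^-1 ^+ N.
  by rewrite mulr_ge0// exprn_ge0// invr_ge0 ltW.
case: ltP => xt; last first.
  rewrite mulr_ge0 ?invr_ge0 ?addr_ge0//.
  by rewrite mulr_ge0// divr_ge0 ?addr_ge0 ?(ltW x0).
have t0' := lt_trans x0 xt.
have tx1 : t^-1 <= x^-1 by rewrite lef_pV2 ?posrE// ltW.
have t1 : t^-1 <= (1 + x) / x * (1 + t)^-1.
  rewrite -[t^-1]mul1r ler_pdivrMr// mulrAC ler_pdivlMr ?ltr_wpDr// mul1r.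
  rewrite mulrAC ler_pdivlMr//; nra.
have -> : top_weight t = (N.+1.*2)`!%:R * t^-1 ^+ N * t^-1 by rewrite /top_weight
  exprSr mulrA.
rewrite -[leRHS]mulrA; apply: ler_pM.
- by rewrite mulr_ge0// exprn_ge0// invr_ge0.
- by rewrite invr_ge0.
- by apply: ler_wpM2l => //; rewrite lerXn2r ?nnegrE ?invr_ge0 ?(ltW x0).
- exact: t1.
Qed.

Let top x t : R := (-1) ^+ N.+1 * kern_jet N.+1%:R (inner_poly N.+1) (outer_poly N.+1)
  N.*2.+1 x t.

Lemma integrable_top x : 0 < x -> mu.-integrable D (EFin \o top x).
Proof.
move=> x0.
have := @integrableZl _ _ _ mu D mD ((-1) ^+ N.+1) _
  (@kern_integrable _ _ _ mD D0 intD (N.+1%:R - N.*2.+1%:R) (inner_jet N.+1%:R N.*2.+1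
    (inner_poly N.+1)) _ _
    (@outer_jet_coef0 R N.+1%:R N.*2.+1 _ (outer_poly_coef0 N)) x0).
by apply: eq_integrable => // t _; rewrite /= EFinM.
Qed.

Lemma st_convex_potentialE x : 0 < x -> st_convex N I x = \int[mu]_(t in D) top x t.
Proof.
move=> x0; rewrite /st_convex (derive_Xn_st_potential mD D0 intD _ _ x0)// -natr1 addrK.
rewrite -RintegralZl//.
by apply: kern_integrable => //;
  exact: (@outer_jet_coef0 R N.+1%:R N.*2.+1 _ (outer_poly_coef0 N)).
Qed.

(** (t - x)_+ - (t - y)_+ lies between y - x times the indicators of t > y and
    of t > x.  Working with increments discards the constant in [kern_jet_top],
    which for K = 1 need not be integrable. *)
Lemma st_convex_potential_sandwich x y : 0 < x -> x < y ->
  (y - x) * tail_mass y <= st_convex N I x - st_convex N I y /\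
  st_convex N I x - st_convex N I y <= (y - x) * tail_mass x.
Proof.
move=> x0 xy; have y0 := lt_trans x0 xy.
have yx : 0 <= y - x by rewrite subr_ge0 ltW.
rewrite !st_convex_potentialE// -RintegralB//; [|exact: integrable_top..].
have topB t : D t -> top x t - top y t =
  top_weight t * (Num.max (t - x) 0 - Num.max (t - y) 0).
  by move=> /D0 t0; rewrite /top !kern_jet_top// -/(top_weight t); ring.
have iB : mu.-integrable D (EFin \o (fun t => top x t - top y t)).
  have := integrableB mD (integrable_top x0) (integrable_top y0).
  by apply: eq_integrable => // t _; rewrite /= EFinB.
have iZ z : 0 < z -> mu.-integrable D (EFin \o (fun t => (y - x) * tail_weight z t)).
  move=> z0; have := @integrableZl _ _ _ mu D mD (y - x) _ (integrable_tail_weight z0).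
  by apply: eq_integrable => // t _; rewrite /= EFinM.
split; rewrite /tail_mass -RintegralZl//; try exact: integrable_tail_weight.
- apply: le_Rintegral => //; first exact: iZ.
  move=> t Dt; rewrite topB// /tail_weight; have t0 := top_weight_ge0 (D0 Dt).
  case: (ltP y t) => yt.
    by rewrite mulrC ler_wpM2l// !max_l; lra.
  rewrite mulr0 mulr_ge0// subr_ge0 [leLHS]max_r ?subr_le0//.
  by rewrite le_max lexx orbT.
- apply: le_Rintegral => //; first exact: iZ.
  move=> t Dt; rewrite topB// /tail_weight; have t0 := top_weight_ge0 (D0 Dt).
  case: (ltP x t) => xt.
    rewrite [leRHS]mulrC ler_wpM2l// [X in X - _]max_l ?subr_ge0 ?(ltW xt)//.
    have : t - y <= Num.max (t - y) 0 by rewrite le_max lexx.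
    lra.
  by rewrite !max_r ?subr_le0// ?subrr ?mulr0// (le_trans xt)// ltW.
Qed.

Lemma convex_pos_st_potential : convex_pos (st_convex N I).
Proof.
apply: (@convex_pos_subgradient _ _ (fun x => - tail_mass x)) => x y x0 xy.
by have [] := st_convex_potential_sandwich x0 xy; lra.
Qed.

(** The descent applied to f = 0 and c = 1. *)
Lemma st_level_potential_ge0 n x : (n <= N)%N -> 0 < x -> 0 <= st_level n I x.
Proof.
move=> nN x0.
have c0 : jet N.*2.+1 (fun _ _ => 0 : R) by move=> j y _ _; exact: is_derive_cst.
have s0 : smooth N.*2.+1 (cst 0 : R -> R) by apply: (jet_of_derive1n _ c0).
have w0 m j y : (j <= N.*2.+1)%N -> 0 < y -> derive_Xn m j (cst 0 : R -> R) y = 0.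
  by move=> jN y0; apply: (jet_derive1n _ c0) => // z _ /=; rewrite mulr0.
have E y : 0 < y -> cst 0 y + 1 * I y = I y by move=> _; rewrite add0r mul1r.
have := @descent_perturbed _ mu D mD D0 intD N (cst 0) 1 s0 _ _ n x nN x0.
rewrite /st_level (derive_Xn_germ _ _ E)//; apply.
- by move=> m y mN y0; rewrite w0 ?mulr0// ltnS leq_double.
- by apply: convex_pos_eq convex_pos_st_potential => y y0;
  rewrite /st_convex (derive_Xn_germ _ _ E).
Qed.

Section subtraction.
Variable (g : R -> R).
Hypothesis cg : convex_pos g.
Hypothesis tail_mass_slope : forall x y, 0 < x -> x < y ->
  tail_mass x - tail_mass y <= right_slope g y - right_slope g x.

Let eta x := right_slope g x + tail_mass x.

Let eta_nd x y : 0 < x -> x <= y -> eta x <= eta y.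
Proof.
move=> x0; rewrite le_eqVlt => /predU1P[->//|xy].
by have := tail_mass_slope x0 xy; rewrite /eta; lra.
Qed.

(** Increments of g and of the potential are both controlled by slopes, but at
    opposite ends of the interval; [subdivision_lower] and [subdivision_upper]
    remove the discrepancy. *)
Lemma subtract_sandwich x y : 0 < x -> x < y ->
  (y - x) * eta x <= (g y - st_convex N I y) - (g x - st_convex N I x) /\
  (g y - st_convex N I y) - (g x - st_convex N I x) <= (y - x) * eta y.
Proof.
move=> x0 xy; split.
- apply: (@subdivision_lower _ (fun x =>
  g x - st_convex N I x) eta tail_mass eta_nd) => // {x0 xy}x {}y x0 xy.
  have [H1 _] := right_slope_sandwich cg x0 xy.
  by have [H2 _] := st_convex_potential_sandwich x0 xy; rewrite /eta; lra.
- apply: (@subdivision_upper _ (fun x =>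
  g x - st_convex N I x) eta tail_mass eta_nd) => // {x0 xy}x {}y x0 xy.
  have [_ H1] := right_slope_sandwich cg x0 xy.
  by have [_ H2] := st_convex_potential_sandwich x0 xy; rewrite /eta; lra.
Qed.

Lemma convex_pos_subtract : convex_pos (fun x => g x - st_convex N I x).
Proof. exact: convex_pos_subgradient subtract_sandwich. Qed.

(** The sum eta of the slope and the tail mass is now constant, so both bounds of
    [subtract_sandwich] coincide. *)
Lemma affine_subtract :
  (forall x y, 0 < x -> x < y -> tail_mass x - tail_mass y =
    right_slope g y - right_slope g x) ->
  exists a b, forall x, 0 < x -> g x - st_convex N I x = a * x + b.
Proof.
move=> tail_mass_eq.
have eta_cst x : 0 < x -> eta x = eta 1.
  move=> x0; case: (ltgtP x 1) => [x1|x1|->//].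
    by have := tail_mass_eq _ _ x0 x1; rewrite /eta; lra.
  by have := tail_mass_eq _ _ ltr01 x1; rewrite /eta; lra.
exists (eta 1), (g 1 - st_convex N I 1 - eta 1) => x x0.
case: (ltgtP x 1) => [x1|x1|->]; last by rewrite mulr1; lra.
  by have [] := subtract_sandwich x0 x1; rewrite (eta_cst x x0); lra.
by have [] := subtract_sandwich ltr01 x1; rewrite (eta_cst x x0); lra.
Qed.

End subtraction.

End potential_top.

(** * Measures with a density *)

Section weighted_measure.
Local Open Scope ereal_scope.
Context d (T : measurableType d) {R : realType}.
Variables (nu : {measure set T -> \bar R}) (w : T -> R).
Hypothesis mw : measurable_fun [set: T] w.
Hypothesis w0 : forall t, (0 <= w t)%R.

Definition weighted (A : set T) : \bar R := \int[nu]_(t in A) (w t)%:E.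

Let mwE A : measurable_fun A (fun t => (w t)%:E).
Proof. by apply/measurable_EFinP; exact: measurable_funTS. Qed.

Let weighted0 : weighted set0 = 0. Proof. exact: integral_set0. Qed.

Let weighted_ge0 A : 0 <= weighted A.
Proof. by apply: integral_ge0 => t _; rewrite lee_fin. Qed.

Let weighted_sigma_additive : semi_sigma_additive weighted.
Proof.
move=> F mF tF mUF; rewrite /weighted ge0_integral_bigcup//.
  by apply: is_cvg_ereal_nneg_natsum_cond => n _ _; exact: weighted_ge0.
by move=> t _; rewrite lee_fin.
Qed.

HB.instance Definition _ := isMeasure.Build _ _ _ weighted
  weighted0 weighted_ge0 weighted_sigma_additive.

Import HBNNSimple.

Let integral_weighted_nnsfun D (h : {nnsfun T >-> R}) : measurable D ->
  \int[weighted]_(t in D) (h t)%:E = \int[nu]_(t in D) ((h t)%:E * (w t)%:E).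
Proof.
move=> mD.
have mi r : measurable_fun D (fun x => (r * \1_(h @^-1` [set r]) x)%:E).
  by apply: (measurable_comp measurableT) => //; exact: measurable_funM.
rewrite [LHS](eq_integral (fun t =>
  \sum_(r \in range h) (r * \1_(h @^-1` [set r]) t)%:E)); last first.
  move=> t _; rewrite fimfunE -fsumEFin//.
rewrite ge0_integral_fsum//; last by move=> r t _; exact: nnfun_muleindic_ge0.
rewrite [RHS](eq_integral (fun t => \sum_(r \in range h)
    ((r * \1_(h @^-1` [set r]) t)%:E * (w t)%:E))); last first.
  move=> t _; rewrite -ge0_mule_fsuml; last by move=> r; exact: nnfun_muleindic_ge0.
  by rewrite [in LHS]fimfunE -fsumEFin//.
rewrite ge0_integral_fsum//; last 2 first.
  - by move=> r; apply: emeasurable_funM.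
  - by move=> r t _; rewrite mule_ge0 ?nnfun_muleindic_ge0// lee_fin.
apply: eq_fsbigr => r; rewrite inE => -[s _ hs].
have r0 : (0 <= r)%R by rewrite -hs.
under eq_integral do rewrite EFinM.
rewrite integralZl_indic_nnsfun//.
under [RHS]eq_integral do rewrite EFinM -muleA.
rewrite [RHS]ge0_integralZl//; last 2 first.
  - by apply: emeasurable_funM => //; apply/measurable_EFinP.
  - by move=> t _; rewrite mule_ge0 ?lee_fin.
congr (_ * _); rewrite integral_indic//= setIC /weighted integral_mkcondr.
by apply: eq_integral => t _; rewrite epatch_indic /= muleC.
Qed.

Lemma ge0_integral_weighted D (h : T -> \bar R) : measurable D ->
  measurable_fun D h -> (forall t, D t -> 0 <= h t) ->
  \int[weighted]_(t in D) h t = \int[nu]_(t in D) (h t * (w t)%:E).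
Proof.
move=> mD mh h0.
pose a := nnsfun_approx mD mh.
have aE t : D t -> (EFin \o a n) t @[n --> \oo] --> h t.
  by move=> Dt; exact: cvg_nnsfun_approx.
transitivity (limn (fun n => \int[weighted]_(t in D) (a n t)%:E)).
  rewrite -monotone_convergence//.
  - by apply: eq_integral => t /[!inE] Dt; apply/esym/cvg_lim => //; exact: aE.
  - by move=> n; apply/measurable_EFinP/measurable_funTS.
  - by move=> n t _; rewrite lee_fin.
  - by move=> t _ m n mn; rewrite lee_fin; exact/lefP/nd_nnsfun_approx.
under eq_fun do rewrite integral_weighted_nnsfun//.
rewrite -monotone_convergence//.
- apply: eq_integral => t /[!inE] Dt; apply/cvg_lim => //.
  by apply: cvgeZr => //; exact: aE.
- move=> n; apply: emeasurable_funM => //.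
  by apply/measurable_EFinP/measurable_funTS.
- by move=> n t _; rewrite mule_ge0 ?lee_fin.
- move=> t _ m n mn; rewrite lee_wpmul2r ?lee_fin//.
  exact/lefP/nd_nnsfun_approx.
Qed.

End weighted_measure.

(** * The measure carried by the slope of a convex function *)

Section representing_measure.
Context {R : realType}.
Variables (g : R -> R) (N : nat).
Hypothesis cg : convex_pos g.
Hypothesis ctg : forall x, 0 < x -> {for x, continuous g}.

(** The right slope lives on the open half-line and may be unbounded near 0.
    Composing with the exponential makes it a cumulative function on the line;
    the Lebesgue-Stieltjes measure is then carried back by the exponential. *)
Definition slope_exp (s : R) : R := right_slope g (expR s).

Let slope_exp_nd : nondecreasing slope_exp.
Proof. by move=> s t st; apply: right_slope_nd; rewrite ?expR_gt0// ler_expR. Qed.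

Let slope_exp_rc : right_continuous slope_exp.
Proof.
move=> s; apply/cvgrPdist_le => e e0.
have es0 := expR_gt0 s.
have H := right_slope_rc cg es0 (ctg es0) e0.
have := @continuous_expR R s; rewrite /continuous_at => /(_ _ H) H'.
near=> t.
have st : s < t by near: t; exact: nbhs_right_gt.
rewrite /slope_exp distrC ger0_norm ?subr_ge0; last first.
  by apply: slope_exp_nd; exact: ltW.
rewrite lerBlDl.
have : expR s < expR t by rewrite ltr_expR.
near: t; exact: cvg_within.
Unshelve. all: by end_near. Qed.

HB.instance Definition _ := isCumulative.Build R _ R slope_exp slope_exp_nd
  slope_exp_rc.

Let lam : {measure set (measurableTypeR R) -> \bar R} :=
  lebesgue_stieltjes_measure slope_exp.

Let lam_itv (a b : R) : a <= b -> lam `]a, b]%classic = (slope_exp b - slope_exp a)%:E.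
Proof.
move=> ab; rewrite /lam /= /lebesgue_stieltjes_measure /measure_extension /=.
rewrite measurable_mu_extE/= ?wlength_itv_bnd//; exact: is_ocitv.
Qed.

Let measurable_exp :
  measurable_fun [set: measurableTypeR R] (expR : measurableTypeR R ->
    measurableTypeR R).
Proof. exact: measurable_expR. Qed.

Let nu : {measure set (measurableTypeR R) -> \bar R} :=
  ltac:(unshelve refine (pushforward lam (expR : measurableTypeR R ->
    measurableTypeR R));
        exact measurable_exp).

Let w (t : R) : R := Num.max t 0 ^+ N.+1 / (N.+1.*2)`!%:R.

Let measurable_w : measurable_fun [set: measurableTypeR R] (w : measurableTypeR R -> R).
Proof.
apply: continuous_measurable_fun => t; apply: cvgMl.
apply: (@continuous_comp _ _ _ (fun t : R => Num.max t 0) (fun s : R => s ^+ N.+1));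
  last exact: exprn_continuous.
by apply: continuous_max; [exact: cvg_id|exact: cvg_cst].
Qed.

Let w_ge0 t : 0 <= w t.
Proof. by rewrite /w divr_ge0// exprn_ge0// le_max lexx orbT. Qed.

Let top_weightK t : 0 < t -> top_weight N t * w t = 1.
Proof.
move=> t0; rewrite /top_weight /w max_l ?(ltW t0)// exprVn.
have : (N.+1.*2)`!%:R != 0 :> R by rewrite pnatr_eq0 -lt0n fact_gt0.
have : t ^+ N.+1 != 0 by rewrite expf_neq0// gt_eqF.
move: (_ `!)%:R (_ ^+ _) => F s s0 F0.
by field; apply/andP.
Qed.

(** The density t^K / (2K)! is the inverse of [top_weight] for t > 0; its
    extension by 0 keeps the measure off the negative half-line and off 0. *)
Lemma representing_measure_ex :
  exists mu : {measure set (measurableTypeR R) -> \bar R},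
   mu `]-oo, 0%R]%classic = 0%E /\
   forall x y : R, 0 < x -> x < y ->
    (\int[mu]_(t in `]x, y]%classic) (top_weight N t)%:E =
      (right_slope g y - right_slope g x)%:E)%E.
Proof.
pose mu : {measure set (measurableTypeR R) -> \bar R} :=
  ltac:(unshelve refine (weighted nu w); [exact measurable_w|exact w_ge0]).
exists mu; split.
  rewrite /= /weighted; apply: integral0_eq => t /=; rewrite in_itv/= => t0.
  by rewrite /w max_r// expr0n mul0r.
move=> x y x0 xy.
have y0 := lt_trans x0 xy.
rewrite ge0_integral_weighted//.
- rewrite (eq_integral (cst 1%E)); last first.
    move=> t; rewrite inE/= in_itv/= => /andP[xt _].
    by rewrite -EFinM top_weightK// (lt_trans x0).
  rewrite integral_cst//= mul1e /nu /= /pushforward.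
  rewrite (_ : _ @^-1` _ = `]ln x, ln y]%classic); last first.
    apply/seteqP; split => s /=; rewrite !in_itv/= => /andP[].
      move=> xs sy; apply/andP; split.
        by rewrite -ltr_expR lnK.
      by rewrite -ler_expR lnK.
    move=> xs sy; apply/andP; split.
      by rewrite -[x]lnK// ltr_expR.
    by rewrite -[y]lnK// ler_expR.
  rewrite lam_itv; last by rewrite ler_ln// ltW.
  by rewrite /slope_exp !lnK.
- apply/measurable_EFinP; apply: (@eq_measurable_fun _ _ _ _ _ (tail_weight N x)).
    by move=> t; rewrite inE /= in_itv/= => /andP[xt _]; rewrite /tail_weight xt.
  exact: measurable_funTS (measurable_tail_weight _ x0).
- move=> t /=; rewrite in_itv/= => /andP[xt _]; rewrite lee_fin top_weight_ge0//.
  by rewrite ltW// (lt_trans x0).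
Qed.

End representing_measure.

(** * From the first level to the function *)

Section base_level.
Context {R : realType}.
Implicit Types (f : R -> R) (x t : R).

(** Level 0 is the derivative of x f. *)
Lemma st_level0_nd M f x y : smooth M.+1 f -> (forall x, 0 < x ->
  0 <= st_level 0 f x) ->
  0 < x -> x <= y -> x * f x <= y * f y.
Proof.
move=> sf Gf x0 xy.
apply: (@le_of_derive _ (fun x => x * f x) (st_level 0 f)) => // s /andP[xs _].
  have s0 := lt_le_trans x0 xs.
  have := derive_Xn_jet 1 sf (isT : (0 < M.+1)%N) s0.
  rewrite /st_level expr0 mul1r => H.
  exact: is_derive_germ H.
by apply: Gf; exact: lt_le_trans xs.
Qed.

Section potential_base.
Context (mu : {measure set (measurableTypeR R) -> \bar R})
  (D : set (measurableTypeR R)).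
Hypothesis mD : measurable D.
Hypothesis D0 : forall t, D t -> 0 <= t.
Hypothesis intD : mu.-integrable D (fun t => ((1 + t)^-1)%:E).
Variable N : nat.

Lemma st_potential_bound : exists2 C : R, 0 <= C & forall x, 0 < x ->
  `|x * st_potential mu D N x| <= C * (x * cauchy_potential mu D x).
Proof.
have [C C0 HC] := @kern_bound R (-1) (inner_poly N.+1) _ (outer_poly_coef0 N).
exists C => // x x0.
rewrite normrM (ger0_norm (ltW x0)) mulrCA ler_wpM2l ?(ltW x0)//.
have ik : mu.-integrable D (EFin \o (fun t => stieltjes_Phi N.+1 x t)).
  have := @kern_integrable _ _ _ mD D0 intD (-1) (inner_poly N.+1) _ _
    (outer_poly_coef0 N) x0.
  by apply: eq_integrable => // t _; rewrite /= stieltjes_PhiE.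
apply: le_trans (le_normr_Rintegral mD ik) _.
rewrite /cauchy_potential -RintegralZl//; last exact: (integrable_invD mD D0 intD).
apply: le_Rintegral => //.
- by have := integrable_norm ik; apply: eq_integrable => // t _ /=.
- have := @integrableZl _ _ _ mu D mD C _ (integrable_invD mD D0 intD x0).
  by apply: eq_integrable => // t _; rewrite /= EFinM.
- move=> t /D0 t0; rewrite stieltjes_PhiE//; apply: le_trans (HC _ _ x0 t0) _.
  by rewrite powRN powRr1 ?(ltW x0)// -mulrA mulKf ?gt_eqF.
Qed.

(** y (f + c I)(y) is non-decreasing, so it suffices to bound it below near 0.
    Mass at distance at least al from 0 gives y I(y) = O(y) there. *)
Lemma base_nonneg f c al : 0 < al -> (forall t, D t -> al <= t) ->
  smooth N.*2.+1 f -> (forall x, 0 < x -> 0 <= f x) ->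
  (forall x, 0 < x -> 0 <= st_level 0 (fun y => f y + c * st_potential mu D N y) x) ->
  forall x, 0 < x -> 0 <= f x + c * st_potential mu D N x.
Proof.
move=> al0 Dal sf f0 Gw x x0.
set I := st_potential mu D N in Gw *.
have sw : smooth N.*2.+1 (fun y => f y + c * I y).
  by apply: smoothDZ; [exact: sf|exact: (@smooth_st_potential _ _ _ mD D0 intD N)].
have nd y : 0 < y -> y <= x -> y * (f y + c * I y) <= x * (f x + c * I x).
  by move=> y0 yx; apply: (st_level0_nd sw).
rewrite -(pmulr_rge0 _ x0) leNgt; apply/negP => neg.
have [C C0 HC] := st_potential_bound.
have Ja := cauchy_potential_ge0 mu D0 al0.
pose M := `|c| * C * (2 * cauchy_potential mu D al) + 1.
have M0 : 0 < M by rewrite ltr_wpDl// !mulr_ge0.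
have Jle y : 0 < y -> cauchy_potential mu D y <= 2 * cauchy_potential mu D al.
  move=> y0; rewrite -RintegralZl//; last exact: (integrable_invD mD D0 intD).
  apply: le_Rintegral => //; first exact: (integrable_invD mD D0 intD).
    have := @integrableZl _ _ _ mu D mD 2 _ (integrable_invD mD D0 intD al0).
    by apply: eq_integrable => // t _; rewrite /= EFinM.
  move=> t Dt; have := Dal _ Dt => alt.
  have yt0 : 0 < y + t by rewrite ltr_wpDr// D0.
  by rewrite ler_pdivlMr ?ler_pdivrMl; lra.
set e := - (x * (f x + c * I x)).
have e0 : 0 < e by rewrite oppr_gt0.
pose y := Num.min x (e / (2 * M)).
have y0 : 0 < y by rewrite lt_min x0 divr_gt0 ?mulr_gt0.
have yx : y <= x by rewrite ge_min lexx.
have ye : y * M <= e / 2.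
  have : y <= e / (2 * M) by rewrite ge_min lexx orbT.
  rewrite ler_pdivlMr ?mulr_gt0// => ?; lra.
have H1 := nd y y0 yx.
have H2 := HC y y0.
have H3 : `|c| * `|y * I y| <= y * M.
  apply: (@le_trans _ _ (`|c| * (C * (y * (2 * cauchy_potential mu D al))))).
    apply: ler_wpM2l => //; apply: le_trans H2 _.
    by apply: ler_wpM2l => //; apply: ler_wpM2l; [exact: ltW|exact: Jle].
  rewrite /M mulrDr mulr1 -[leLHS]addr0 lerD ?(ltW y0)//.
  by rewrite le_eqVlt; apply/orP; left; apply/eqP; ring.
have H4 : - (`|c| * `|y * I y|) <= c * (y * I y).
  by rewrite lerNl -normrM -normrN ler_norm.
have H5 : 0 <= y * f y by rewrite mulr_ge0 ?f0// ltW.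
have : y * (f y + c * I y) = y * f y + c * (y * I y) by ring.
rewrite /e in e0 ye; lra.
Qed.

End potential_base.
End base_level.

(** * Positivity of the kernel *)

Section kernel_positivity.
Context {R : realType}.
Variable N : nat.
Implicit Types (f : R -> R) (x y t : R).

(** Phi(., t) is the potential of a Dirac mass at t, to which the descent
    applies. *)
Lemma Phi_ge0_nd t : 0 < t ->
  (forall x, 0 < x -> 0 <= stieltjes_Phi N.+1 x t) /\
  (forall x y, 0 < x -> x <= y ->
     x * stieltjes_Phi N.+1 x t <= y * stieltjes_Phi N.+1 y t).
Proof.
move=> t0.
pose mu : {measure set (measurableTypeR R) -> \bar R} := \d_(t : measurableTypeR R).
pose D : set (measurableTypeR R) := [set t].
have mD : measurable D by exact: measurable_set1.
have D0 s : D s -> 0 <= s by move=> ->; exact: ltW.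
have intE (h : measurableTypeR R -> R) : (\int[mu]_(s in D) (h s)%:E = (h t)%:E)%E.
  rewrite (eq_integral (cst (h t)%:E)); last by move=> s; rewrite inE => ->.
  by rewrite integral_cst// /mu /= diracE mem_set// mule1.
have intD : mu.-integrable D (fun s => ((1 + s)^-1)%:E).
  apply/integrableP; split.
    apply: (@eq_measurable_fun _ _ _ _ _ (cst ((1 + t)^-1)%:E));
      last exact: measurable_cst.
    by move=> s; rewrite inE => ->.
  rewrite (eq_integral (fun s : measurableTypeR R => (`|(1 + s)^-1|)%:E));
    last by move=> s _; rewrite abse_EFin.
  by rewrite (intE (fun s : measurableTypeR R => `|(1 + s)^-1|)) ltry.
have E x : st_potential mu D N x = stieltjes_Phi N.+1 x t.
  by rewrite /st_potential /Rintegral intE.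
have s0 : smooth N.*2.+1 (cst 0 : R -> R).
  by apply: (@jet_of_derive1n _ _ (fun _ _ => 0)) => // j y _ _; exact: is_derive_cst.
have ss := @smooth_st_potential _ mu D mD D0 intD N.
have Gs x : 0 < x -> 0 <= st_level 0 (st_potential mu D N) x.
  by move=> x0; exact: st_level_potential_ge0.
split=> [x x0|x y x0 xy].
  have := @base_nonneg _ mu D mD D0 intD N (cst 0) 1 t t0 _ s0.
  have W y : 0 < y -> cst 0 y + 1 * st_potential mu D N y = st_potential mu D N y.
    by move=> _; rewrite add0r mul1r.
  move=> /(_ _ _ _ x x0); rewrite W// E; apply.
  - by move=> s ->.
  - by [].
  - by move=> y y0; rewrite /st_level (derive_Xn_germ _ _ W)//; exact: Gs.
by rewrite -!E; exact: (st_level0_nd ss).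
Qed.

(** The two branches agree on the diagonal: P(1) = P(0) - P(1). *)
Lemma inner_poly_horner1 : (inner_poly N.+1).[1] = (inner_poly N.+1)`_0 / 2 :> R.
Proof.
have := @gap_dvd1 R N.+1 N.*2.+1 (inner_poly N.+1) (outer_poly N.+1) (size_outer_poly
  _) (gap_dvd (leqnn _)).
by rewrite [in X in _ = X -> _]/outer_poly hornerD hornerN hornerC; lra.
Qed.

Lemma inner_poly0_gt0 : 0 < (inner_poly N.+1)`_0 :> R.
Proof. by rewrite coef_inner_poly expr0 mulr1 ltr0n bin_gt0 add0n mul2n -addnn
  leq_addr. Qed.

Lemma Phi_at0 x : 0 < x -> stieltjes_Phi N.+1 x 0 = (inner_poly N.+1)`_0 / x.
Proof.
move=> x0; rewrite stieltjes_PhiE// /kern (ltW x0) mul0r horner_coef0.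
by rewrite powRN powRr1 ?(ltW x0)// mulrC.
Qed.

Lemma Phi_ge0 x t : 0 < x -> 0 <= t -> 0 <= stieltjes_Phi N.+1 x t.
Proof.
move=> x0; rewrite le_eqVlt => /predU1P[<-|t0].
  by rewrite Phi_at0// divr_ge0 ?(ltW inner_poly0_gt0) ?(ltW x0).
by have [+ _] := Phi_ge0_nd t0; apply.
Qed.

Lemma Phi_ge_below x t : 0 < x -> 0 <= t -> t <= x ->
  (inner_poly N.+1)`_0 / 2 / x <= stieltjes_Phi N.+1 x t.
Proof.
move=> x0 + tx; have A0 := inner_poly0_gt0; rewrite le_eqVlt => /predU1P[<-|t0].
  by rewrite Phi_at0// ler_pM2r ?invr_gt0//; lra.
have [_ /(_ t x t0 tx)] := Phi_ge0_nd t0.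
rewrite [in X in X <= _ -> _]stieltjes_PhiE// {1}/kern lexx divff ?gt_eqF//
  inner_poly_horner1.
rewrite powRN powRr1 ?(ltW t0)// mulVKf ?gt_eqF//.
by move=> H; rewrite ler_pdivrMr// (le_trans H)// mulrC.
Qed.

(** The outer polynomial vanishes at 0 with positive derivative. *)
Lemma Phi_ge_above : exists2 X : R, 1 <= X &
  forall t, X <= t -> (outer_poly N.+1)`_1 / 2 / t <= stieltjes_Phi N.+1 1 t.
Proof.
pose B1 : {poly R} := outer_poly N.+1 %/ 'X.
have BE : outer_poly N.+1 = B1 * 'X :> {poly R}.
  by apply/eqP; rewrite -dvdp_eq -['X]subr0 dvdp_XsubCl rootE horner_coef0
    outer_poly_coef0.
have B10 : B1.[0] = (outer_poly N.+1)`_1 by rewrite BE coefMX /= horner_coef0.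
have Bpos : 0 < (outer_poly N.+1)`_1 :> R.
  by rewrite coef_outer_poly /= expr1 mulrN1 opprK ltr0n bin_gt0; lia.
have := @continuous_horner _ B1 (0 : R).
move=> /(cvgr_ge B1.[0]) /(_ (B1.[0] / 2)).
rewrite B10 => /(_ (ltac:(lra))).
rewrite -nbhs_nearE => /nbhs_ballP[d /= d0 Hd].
exists (Num.max 2 (2 / d)); first by rewrite le_max; apply/orP; left; lra.
move=> t; rewrite ge_max => /andP[t2 td].
have t0 : 0 < t by lra.
rewrite stieltjes_PhiE// /kern ifF; last by apply/negbTE; rewrite -ltNge; lra.
rewrite powR1 mul1r [in leRHS]BE hornerM hornerX mul1r ler_pM2r ?invr_gt0//.
apply: Hd; rewrite /ball /= sub0r normrN ger0_norm ?invr_ge0 ?(ltW t0)//.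
rewrite invf_plt ?posrE//; apply: lt_le_trans td.
by rewrite -[ltLHS]mul1r ltr_pM2r ?invr_gt0//; lra.
Qed.

(** Phi(1, .) handles large t by [Phi_ge_above].  For the remaining t, which are
    at most X, [Phi_ge_below] applies to Phi(X, .). *)
Lemma weight_le_Phi : exists (c X : R), [/\ 0 < c, 1 <= X &
  forall t, 0 <= t ->
    (1 + t)^-1 <= c * (stieltjes_Phi N.+1 1 t + stieltjes_Phi N.+1 X t)].
Proof.
have [X X1 HX] := Phi_ge_above.
have A0 := inner_poly0_gt0.
have Bpos : 0 < (outer_poly N.+1)`_1 :> R.
  by rewrite coef_outer_poly /= expr1 mulrN1 opprK ltr0n bin_gt0; lia.
have X0 : 0 < X by lra.
pose a : R := (inner_poly N.+1)`_0 / 2 / X; pose b : R := (outer_poly N.+1)`_1 / 2.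
have a0 : 0 < a by rewrite !divr_gt0.
have b0 : 0 < b by rewrite divr_gt0.
exists (a^-1 + b^-1), X; split => //; first by rewrite addr_gt0 ?invr_gt0.
move=> t t0.
have P1 := @Phi_ge0 1 t ltr01 t0; have P2 := @Phi_ge0 X t X0 t0.
have t10 : 0 < 1 + t by lra.
have ab : 0 < a^-1 + b^-1 by rewrite addr_gt0 ?invr_gt0.
have [tX|Xt] := leP t X.
  have := Phi_ge_below X0 t0 tX; rewrite -/a => H.
  apply: (@le_trans _ _ 1); first by rewrite invf_le1// lerDl.
  apply: (@le_trans _ _ (a^-1 * a)); first by rewrite mulVf// gt_eqF.
  apply: ler_pM; [by rewrite invr_ge0 ltW|exact: ltW| |lra].
  by rewrite lerDl invr_ge0 ltW.
have := HX t (ltW Xt); rewrite -/b => H.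
have tp : 0 < t by lra.
apply: (@le_trans _ _ (b^-1 * (b / t))).
  by rewrite mulKf ?gt_eqF// lef_pV2 ?posrE//; lra.
apply: ler_pM; [by rewrite invr_ge0 ltW|by rewrite divr_ge0// ltW| |lra].
by rewrite lerDr invr_ge0 ltW.
Qed.

End kernel_positivity.

(** * Truncated potentials stay below the function *)

Section truncation.
Context {R : realType}.
Variables (N : nat) (f : R -> R).
Hypothesis sf : smooth N.*2.+1 f.
Hypothesis f0 : forall x, 0 < x -> 0 <= f x.
Hypothesis Gf : forall n x, (n <= N)%N -> 0 < x -> 0 <= st_level n f x.
Hypothesis cT : convex_pos (st_convex N f).
Variable mu : {measure set (measurableTypeR R) -> \bar R}.
Hypothesis muE : forall x y : R, 0 < x -> x < y ->
    (\int[mu]_(t in `]x, y]%classic) (top_weight N t)%:E =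
      (right_slope (st_convex N f) y - right_slope (st_convex N f) x)%:E)%E.
Implicit Types (x y t : R).

Lemma measurable_top_weight x y : 0 < x ->
  measurable_fun (`]x, y]%classic : set (measurableTypeR R)) (fun t =>
    (top_weight N t)%:E).
Proof.
move=> x0; apply/measurable_EFinP;
  apply: (@eq_measurable_fun _ _ _ _ _ (tail_weight N x)).
  by move=> t; rewrite inE /= in_itv/= => /andP[xt _]; rewrite /tail_weight xt.
exact: measurable_funTS (measurable_tail_weight _ x0).
Qed.

Lemma integrable_top_weight x y : 0 < x -> x < y ->
  mu.-integrable (`]x, y]%classic : set (measurableTypeR R)) (fun t =>
    (top_weight N t)%:E).
Proof.
move=> x0 xy; apply/integrableP; split; first exact: measurable_top_weight.
rewrite (eq_integral (fun t : measurableTypeR R => (top_weight N t)%:E));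
  first by rewrite muE// ltry.
move=> t; rewrite inE /= in_itv/= => /andP[xt _].
by rewrite /= ger0_norm// top_weight_ge0// ltW// (lt_trans x0).
Qed.

Section difference.
Variable D : set (measurableTypeR R).
Hypothesis mD : measurable D.
Hypothesis D0 : forall t, D t -> 0 <= t.
Hypothesis intD : mu.-integrable D (fun t => ((1 + t)^-1)%:E).

Lemma tail_mass_diff x y : 0 < x -> x < y ->
  tail_mass mu D N x - tail_mass mu D N y =
    \int[mu]_(t in D `&` `]x, y]%classic) top_weight N t.
Proof.
move=> x0 xy; rewrite /tail_mass -RintegralB//;
  [|exact: (integrable_tail_weight mD D0 intD)|]; last first.
  exact: (integrable_tail_weight mD D0 intD _ (lt_trans x0 xy)).
rewrite Rintegral_mkcondr; apply: eq_Rintegral => t _.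
rewrite /tail_weight patchE.
case: (boolP (t \in (`]x, y]%classic : set (measurableTypeR R)))).
  by rewrite inE /= in_itv/= => /andP[-> ty]; rewrite ltNge ty /= subr0.
rewrite notin_setE /= in_itv/= => /negP; rewrite negb_and -leNgt -ltNge.
case: (ltP x t) => xt /=; first by move=> ->; rewrite subrr.
by move=> _; rewrite ltNge (le_trans xt (ltW xy)) /= subrr.
Qed.

(** Over D the mass between x and y is at most that of the whole measure, which
    is the increment of the slope.  Equality holds when D contains the interval. *)
Lemma tail_mass_diff_le x y : 0 < x -> x < y ->
  tail_mass mu D N x - tail_mass mu D N y <=
    right_slope (st_convex N f) y - right_slope (st_convex N f) x.
Proof.
move=> x0 xy; rewrite tail_mass_diff// -lee_fin -muE// /Rintegral.
have mI : measurable (`]x, y]%classic : set (measurableTypeR R)) by exact: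
  measurable_itv.
have wpos t : (`]x, y]%classic : set (measurableTypeR R)) t ->
  (0 <= (top_weight N t)%:E)%E.
  rewrite /= in_itv/= => /andP[xt _]; rewrite lee_fin top_weight_ge0//.
  by rewrite ltW// (lt_trans x0).
rewrite fineK.
  apply: ge0_subset_integral => //; [exact: measurableI|exact: measurable_top_weight].
apply: integrable_fin_num; first exact: measurableI.
by apply: integrableS (integrable_top_weight x0 xy) => //; exact: measurableI.
Qed.

(** Subtracting any part of the potential preserves all sign conditions. *)
Lemma descent_minus n x : (n <= N)%N -> 0 < x ->
  0 <= st_level n (fun y => f y + -1 * st_potential mu D N y) x.
Proof.
apply: (descent_perturbed mD D0 intD sf Gf).
apply: (convex_pos_eq _ (convex_pos_subtract mD D0 intD cT tail_mass_diff_le)) => z z0.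
by rewrite (st_convex_DZ mD D0 intD)// mulN1r.
Qed.

End difference.

(** Compact intervals exhausting the open half-line; n = 0 would be empty, so
    they are used from index 1 on. *)
Definition trunc n : set (measurableTypeR R) := `]n.+1%:R^-1, n.+1%:R]%classic.

Lemma trunc_gt n t : trunc n t -> n.+1%:R^-1 < t.
Proof. by rewrite /trunc /= in_itv/= => /andP[]. Qed.

Lemma measurable_trunc n : measurable (trunc n).
Proof. exact: measurable_itv. Qed.

Lemma trunc_ge0 n t : trunc n t -> 0 <= t.
Proof. by move=> /trunc_gt /ltW; apply: le_trans. Qed.

(** On a compact interval away from 0 the density [top_weight] is bounded below
    and its integral is an increment of the slope. *)
Lemma integrable_trunc n : mu.-integrable (trunc n.+1) (fun t => ((1 + t)^-1)%:E).
Proof.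
have n1 : n.+2%:R^-1 < n.+2%:R :> R.
  by rewrite invf_plt ?posrE// ?ltr1n//; apply: lt_le_trans (_ : 1 <= _);
    rewrite ?invf_lt1 ?ltr1n// ler1n.
have n0 : 0 < n.+2%:R^-1 :> R by [].
have mt : measurable (trunc n.+1) by exact: measurable_itv.
have := @integrableZl _ _ _ mu (trunc n.+1) mt (n.+2%:R ^+ N.+1) _
  (integrable_top_weight n0 n1).
apply: le_integrable => //.
  exact: measurable_weight (@trunc_ge0 n.+1).
move=> t Dt; have t0 := trunc_ge0 Dt.
have tp : 0 < t by apply: lt_trans (trunc_gt Dt).
rewrite abse_EFin lee_fin ger0_norm ?invr_ge0 ?addr_ge0//.
rewrite ger0_norm ?(mulr_ge0 _ (top_weight_ge0 N t0)) ?exprn_ge0//.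
apply: (@le_trans _ _ 1); first by rewrite invf_le1 ?lerDl// ltr_wpDr.
have F1 : 1 <= (N.+1.*2)`!%:R :> R by rewrite ler1n fact_gt0.
rewrite /top_weight; move: F1; move: (_ `!)%:R => F F1.
rewrite mulrCA -exprMn.
have : 1 <= n.+2%:R * t^-1.
  rewrite ler_pdivlMr// mul1r.
  by move: Dt; rewrite /trunc /= in_itv/= => /andP[].
move=> /(exprn_ege1 N.+1); nra.
Qed.

Lemma integrable_Phi_on (D : set (measurableTypeR R)) x : measurable D ->
  (forall t, D t -> 0 <= t) ->
  mu.-integrable D (fun t => ((1 + t)^-1)%:E) -> 0 < x ->
  mu.-integrable D (fun t => (stieltjes_Phi N.+1 x t)%:E).
Proof.
move=> mD D0 intD x0.
have := @kern_integrable _ _ _ mD D0 intD (-1) (inner_poly N.+1) _ _ (outer_poly_coef0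
  N) x0.
by apply: eq_integrable => // t _; rewrite /= stieltjes_PhiE.
Qed.

Lemma measurable_Phi x : 0 < x ->
  measurable_fun [set: measurableTypeR R] (fun t : measurableTypeR R =>
    (stieltjes_Phi N.+1 x t)%:E).
Proof.
move=> x0; under eq_fun do rewrite stieltjes_PhiE//.
by apply/measurable_EFinP; exact: measurable_kern.
Qed.

Lemma potential_trunc_le n x : 0 < x -> st_potential mu (trunc n.+1) N x <= f x.
Proof.
move=> x0; have mt := @measurable_trunc n.+1; have it := integrable_trunc n.
have al0 : 0 < n.+2%:R^-1 :> R by [].
have Gw y : 0 < y -> 0 <= st_level 0 (fun z =>
  f z + -1 * st_potential mu (trunc n.+1) N z) y.
  by apply: descent_minus => //; exact: trunc_ge0.
have := base_nonneg mt (@trunc_ge0 n.+1) it al0 (fun t Dt =>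
  ltW (trunc_gt Dt)) sf f0 Gw x0.
by rewrite mulN1r subr_ge0.
Qed.

Lemma bigcup_trunc : \bigcup_n trunc n.+1 = `]0%R, +oo[%classic.
Proof.
apply/seteqP; split => [t [n _ /trunc_gt nt]|t].
  by rewrite /= in_itv/= andbT; exact: lt_trans nt.
rewrite /= in_itv/= andbT => t0.
near \oo => n; exists n => //; rewrite /trunc /= in_itv/=; apply/andP; split.
  rewrite invf_plt ?posrE//.
  apply: (@lt_le_trans _ _ n%:R); last by rewrite ler_nat ltnW.
  by near: n; exact: nbhs_infty_gtr.
apply: (@le_trans _ _ n%:R); last by rewrite ler_nat ltnW.
by near: n; exact: nbhs_infty_ger.
Unshelve. all: by end_near. Qed.

(** Monotone convergence along the truncations. *)
Lemma integral_Phi_le x : 0 < x ->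
  (\int[mu]_(t in `]0%R, +oo[) (stieltjes_Phi N.+1 x t)%:E <= (f x)%:E)%E.
Proof.
move=> x0; rewrite -bigcup_trunc.
have cv := @ge0_nondecreasing_set_cvg_integral _ _ R (fun n => trunc n.+1)
  (fun t => (stieltjes_Phi N.+1 x t)%:E) mu.
apply: (cvge_to_le (cv _ _ _ _)).
- apply/nondecreasing_seqP => n; rewrite subsetEset => t.
  rewrite /trunc /= !in_itv/= => /andP[t1 t2]; apply/andP; split.
    by apply: le_lt_trans t1; rewrite lef_pV2 ?posrE// ler_nat.
  by apply: le_trans t2 _; rewrite ler_nat.
- by move=> n; exact: measurable_trunc.
- by move=> n; apply: measurable_funTS; exact: measurable_Phi.
- by move=> n t /trunc_ge0 t0; rewrite lee_fin Phi_ge0.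
apply: nearW => n.
have it := integrable_trunc n; have mt := @measurable_trunc n.+1.
have iP := integrable_Phi_on mt (@trunc_ge0 n.+1) it x0.
rewrite -[leLHS]fineK; last exact: (integrable_fin_num mt iP).
by rewrite lee_fin; exact: potential_trunc_le.
Qed.

Lemma integrable_pos : mu.-integrable `]0%R, +oo[%classic (fun t => ((1 + t)^-1)%:E).
Proof.
have mD : measurable (`]0%R, +oo[%classic : set (measurableTypeR R)) by exact:
  measurable_itv.
have [c [X [c0 X1 H]]] := @weight_le_Phi R N.
have X0 : 0 < X by exact: lt_le_trans X1.
have D0 (t : measurableTypeR R) : `]0%R, +oo[%classic t -> 0 <= t.
  by rewrite /= in_itv/= andbT => /ltW.
have mg := measurable_weight D0.
have P0 x t : 0 < x -> (`]0%R, +oo[%classic : set (measurableTypeR R)) t ->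
  (0 <= (stieltjes_Phi N.+1 x t)%:E)%E.
  by rewrite /= in_itv/= andbT lee_fin => x0 /ltW; exact: Phi_ge0.
have mP x : 0 < x -> measurable_fun (`]0%R, +oo[%classic : set (measurableTypeR R))
  (fun t => (stieltjes_Phi N.+1 x t)%:E).
  by move=> x0; apply: measurable_funTS; exact: measurable_Phi.
apply/integrableP; split => //.
apply: (@le_lt_trans _ _ (\int[mu]_(t in `]0%R, +oo[) (c%:E * ((stieltjes_Phi N.+1 1
  t)%:E + (stieltjes_Phi N.+1 X t)%:E)))%E).
  apply: ge0_le_integral => //.
  - exact: measurableT_comp.
  - apply: measurable_funeM; apply: emeasurable_funD; exact: mP.
  - move=> t Dt; have t0 : 0 <= t by move: Dt; rewrite /= in_itv/= andbT => /ltW.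
    rewrite abse_EFin ger0_norm ?invr_ge0 ?addr_ge0//.
    by rewrite -EFinD -EFinM lee_fin H.
rewrite ge0_integralZl//; last 3 first.
- apply: emeasurable_funD; exact: mP.
- by move=> t Dt; rewrite adde_ge0 ?P0.
- by rewrite lee_fin ltW.
rewrite ge0_integralD//; [|by move=> t; exact: P0|exact: mP|by move=> t;
  exact: P0|exact: mP].
have I1 := integral_Phi_le ltr01; have I2 := integral_Phi_le X0.
rewrite lte_mul_pinfty ?lee_fin ?(ltW c0)//.
by apply: le_lt_trans (leeD I1 I2) _; rewrite -EFinD ltry.
Qed.

End truncation.

(** * Polynomial remainders *)

Section polynomial_endgame.
Context {R : realType}.
Implicit Types (p q : {poly R}) (x : R).

(** The formal antiderivative differs from h by a function with zero
    derivative. *)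
Lemma antiderivative_poly (h : R -> R) p :
  (forall x, 0 < x -> is_derive x (1 : R) h p.[x]) ->
  exists2 q : {poly R}, (size q <= (size p).+1)%N & forall x, 0 < x -> h x = q.[x].
Proof.
move=> dh.
pose P : {poly R} := \poly_(i < (size p).+1) (p`_i.-1 / i%:R).
have dP : deriv P = p.
  apply/polyP => i; rewrite coef_deriv coef_poly ltnS.
  have [ip|pi] := ltnP i (size p); last by rewrite mul0rn nth_default.
  by rewrite /= -[RHS]mulr1 -[LHS]mulr_natr divfK ?pnatr_eq0 ?mulr1.
have dD x : 0 < x -> is_derive x (1 : R) (fun x => h x - P.[x]) 0.
  move=> x0; have D1 := dh x x0; have D2 := is_derive_poly P x.
  by apply: is_derive_eq (is_deriveB D1 D2) _; rewrite dP subrr.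
have cst x y : 0 < x -> x <= y -> h x - P.[x] = h y - P.[y].
  move=> x0 xy; apply/eqP; rewrite eq_le; apply/andP; split.
    apply: (@le_of_derive _ (fun x => h x - P.[x]) (fun _ => 0)) => // s /andP[xs _].
    by apply: dD; exact: lt_le_trans xs.
  rewrite -lerN2.
  apply: (@le_of_derive _ (fun x => - (h x - P.[x])) (fun _ => 0)) => // s /andP[xs _].
  apply: is_derive_eq (is_deriveN (dD s (lt_le_trans x0 xs))) _.
  by rewrite oppr0.
exists (P + (h 1 - P.[1])%:P).
  rewrite (leq_trans (size_polyD _ _))// geq_max size_poly/=.
  by rewrite (leq_trans (size_polyC_leq1 _)).
move=> x x0; rewrite hornerD hornerC.
suff -> : h 1 - P.[1] = h x - P.[x] by rewrite addrC subrK.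
by have [x1|/ltW x1] := leP 1 x; [|symmetry]; exact: cst.
Qed.

Lemma jet_poly M (u : nat -> R -> R) p : jet M u ->
  (forall x, 0 < x -> u M x = p.[x]) ->
  exists2 q : {poly R}, (size q <= size p + M)%N & forall x, 0 < x -> u 0%N x = q.[x].
Proof.
elim: M p => [|M ih] p ju uM; first by exists p => //; rewrite addn0.
have [|q sq uq] := @antiderivative_poly (u M) p.
  by move=> x x0; rewrite -uM//; exact: ju.
have [q' sq' uq'] := ih q (jet_leq (leqnSn _) ju) uq.
exists q' => //; rewrite (leq_trans sq')// addnS -addSn.
by rewrite leq_add2r.
Qed.

Lemma poly_small_root q (C : R) :
  (forall x, 0 < x -> x <= 1 -> `|q.[x]| <= C * x) -> q.[0] = 0.
Proof.
move=> H; apply/eqP; rewrite -normr_le0.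
have c1 : `|q.[x]| @[x --> 0^'+] --> `|q.[0]|.
  by apply: cvg_at_right_filter; apply: cvg_norm; exact: continuous_horner.
have c2 : C * x @[x --> (0:R)^'+] --> C * 0.
  by apply: cvg_at_right_filter; apply: cvgMr; exact: cvg_id.
rewrite -[leRHS](mulr0 C).
apply: (ler_cvg_to c1 c2); near=> x; apply: H => //.
by apply/ltW; near: x; exact: nbhs_right_lt.
Unshelve. all: by end_near. Qed.

(** A polynomial has the sign of its leading coefficient near infinity. *)
Lemma poly_lead_ge0 p : (forall x, 0 < x -> 0 <= p.[x]) -> 0 <= lead_coef p.
Proof.
move=> p0; rewrite leNgt; apply/negP => lp.
have : 0 < lead_coef (- p) by rewrite lead_coefN oppr_gt0.
move=> /[dup] l0 /poly_pinfty_gt_lc [y Hy].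
have := Hy (Num.max y 1); rewrite le_max lexx => /(_ isT).
have := p0 (Num.max y 1); rewrite lt_max ltr01 orbT => /(_ isT).
by rewrite hornerN; lra.
Qed.

(** If q has degree d >= 2, its leading coefficient c is positive and
    (X q)''' has leading coefficient (d+1) d (d-1) c > 0. *)
Lemma poly_growth q : (forall x, 0 < x -> 0 <= q.[x]) ->
  (forall x, 0 < x -> (derivn 3 ('X * q)).[x] <= 0) -> (size q <= 2)%N.
Proof.
move=> q0 q3; rewrite leqNgt; apply/negP => sq.
have lq : 0 < lead_coef q.
  rewrite lt_neqAle eq_sym lead_coef_eq0 poly_lead_ge0// andbT.
  by rewrite -size_poly_gt0 (leq_trans _ sq).
pose s := derivn 3 ('X * q).
have cs i : s`_i = q`_(i + 2) *+ (i + 3) ^_ 3.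
  by rewrite /s coef_derivn coefXM addnC /= addn3 /= addn2.
have ls : 0 < lead_coef s.
  rewrite (_ : lead_coef s = s`_(size q - 3)).
    rewrite cs (_ : size q - 3 + 2 = (size q).-1)%N; last by lia.
    by rewrite pmulrn_rgt0// ffact_gt0; lia.
  rewrite lead_coefE; congr (s`_ _).
  rewrite (_ : size s = (size q - 3).+1)//.
  apply/eqP; rewrite eqn_leq; apply/andP; split.
    apply/leq_sizeP => j jq; rewrite cs nth_default ?mul0rn//.
    by have aux (m i : nat) : (m - 3 < i)%N -> (m <= i + 2)%N; [lia|exact: aux].
  rewrite ltnNge; apply/negP => /leq_sizeP /(_ _ (leqnn _)) /eqP.
  rewrite cs (_ : size q - 3 + 2 = (size q).-1)%N; last by lia.
  rewrite mulrn_eq0 -lead_coefE (gt_eqF lq) orbF => /eqP.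
  by apply/eqP; rewrite -lt0n ffact_gt0; lia.
have : 0 <= lead_coef (- s).
  by apply: poly_lead_ge0 => x x0; rewrite hornerN oppr_ge0; exact: q3.
by rewrite lead_coefN oppr_ge0 leNgt ls.
Qed.

(** x w is non-negative and non-decreasing, hence bounded near 0: this divides p
    by X^(N+1).  The quotient x w is a polynomial, of degree at most 1 by
    [poly_growth] when the second level is available and by its size when N = 0. *)
Lemma polynomial_remainder N (w : R -> R) p : smooth N.*2.+1 w ->
  (forall x, 0 < x -> 0 <= w x) ->
  (forall n x, (n <= N)%N -> 0 < x -> 0 <= st_level n w x) ->
  (size p <= N.*2.+3)%N -> (forall x, 0 < x -> x ^+ N.+2 * w x = p.[x]) ->
  exists a b : R, [/\ 0 <= a, 0 <= b & forall x, 0 < x -> w x = a + b / x].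
Proof.
move=> sw w0 Gw sp pE.
have nd x y : 0 < x -> x <= y -> x * w x <= y * w y.
  by apply: (st_level0_nd sw) => x0; exact: Gw.
have [q qE] : exists q : {poly R}, p = q * 'X^(N.+1).
  have H m : (m <= N.+1)%N -> exists q : {poly R}, p = q * 'X^m.
    elim: m => [|m ih] mN; first by exists p; rewrite expr0 mulr1.
    have [q qE] := ih (ltnW mN).
    have q00 : q.[0] = 0.
      apply: (@poly_small_root _ (w 1)) => x x0 x1.
      have : x ^+ m * q.[x] = x ^+ m * (x ^+ (N.+1 - m) * (x * w x)).
        have H : x ^+ N.+2 * w x = q.[x] * x ^+ m by rewrite pE// qE hornerM hornerXn.
        by rewrite mulrC -H !mulrA -exprD subnKC ?(ltnW mN)// -exprSr.
      move=> /mulfI; rewrite expf_neq0 ?gt_eqF// => /(_ isT) ->.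
      rewrite subSn// exprSr -mulrA.
      have xw0 : 0 <= x * w x by rewrite mulr_ge0 ?w0// ltW.
      have xw1 : x * w x <= w 1 by have := nd x 1 x0 x1; rewrite mul1r.
      have xn1 : x ^+ (N - m) <= 1 by rewrite exprn_ile1// ltW.
      have xn0 : 0 <= x ^+ (N - m) by rewrite exprn_ge0// ltW.
      have pos : 0 <= x ^+ (N - m) * (x * (x * w x)).
        by rewrite mulr_ge0// mulr_ge0// ltW.
      rewrite ger0_norm// mulrCA [leRHS]mulrC ler_pM2l// -[leRHS]mul1r.
      by apply: ler_pM.
    move: q00 => /eqP; rewrite -[_ == 0]/(root q 0) -dvdp_XsubCl subr0 => /dvdpP[r rE].
    by exists r; rewrite qE rE exprS mulrA.
  exact: H.
have wq x : 0 < x -> x * w x = q.[x].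
  move=> x0; have H : x ^+ N.+1 * (x * w x) = x ^+ N.+1 * q.[x].
    by rewrite mulrA -exprSr pE// qE hornerM hornerXn mulrC.
  by move: H => /mulfI; rewrite expf_neq0 ?gt_eqF// => /(_ isT).
have sq : (size q <= 2)%N.
  have [q_eq0|q_neq0] := eqVneq q 0; first by rewrite q_eq0 size_poly0.
  have sq2 : (size q <= N.+2)%N.
    by move: sp; rewrite qE size_mulXn//; lia.
  case: N sw Gw sp pE qE sq2 => [//|n] sw Gw _ _ _ _.
  apply: poly_growth => x x0; first by rewrite -wq// mulr_ge0 ?w0// ltW.
  have := Gw 1%N x isT x0; rewrite /st_level expr1 mulN1r oppr_ge0.
  suff -> : derive_Xn 2 3 w x = (derivn 3 ('X * q)).[x] by [].
  have jq : jet 3 (fun j x => (derivn j ('X * q)).[x]).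
    move=> j y _ _; rewrite derivnS; exact: is_derive_poly.
  apply: (jet_derive1n _ jq) => // y y0.
  by rewrite derivn0 hornerM hornerX -wq// expr2 mulrA.
have q2 x : q.[x] = q`_0 + q`_1 * x.
  by rewrite (horner_coef_wide _ sq) !big_ord_recl big_ord0 /= expr0 expr1 mulr1 addr0.
have wE x : 0 < x -> w x = q`_1 + q`_0 / x.
  move=> x0; have := wq x x0; rewrite q2 => H.
  have xn0 : x != 0 by rewrite gt_eqF.
  by apply: (mulfI xn0); rewrite H; field.
exists q`_1, q`_0; split => //.
- rewrite leNgt; apply/negP => a0.
  have q0n : 0 <= `|q`_0| by [].
  (* A negative coefficient of x would make x w negative here. *)
  pose x := (`|q`_0| + 1) / - q`_1.
  have x0 : 0 < x by rewrite divr_gt0 ?oppr_gt0// ltr_wpDl.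
  have := mulr_ge0 (ltW x0) (w0 x x0); rewrite wq// q2.
  have -> : q`_1 * x = - (`|q`_0| + 1) by rewrite /x; field; rewrite lt_eqF.
  have := ler_norm q`_0; lra.
- rewrite leNgt; apply/negP => b0.
  (* A negative constant term would make x w negative here. *)
  pose x := - q`_0 / (2 * (`|q`_1| + 1)).
  have d0 : 0 < 2 * (`|q`_1| + 1) by rewrite mulr_gt0// ltr_wpDl.
  have x0 : 0 < x by rewrite divr_gt0 ?oppr_gt0.
  have := mulr_ge0 (ltW x0) (w0 x x0); rewrite wq// q2.
  have : q`_1 * x <= (`|q`_1| + 1) * x by rewrite ler_wpM2r ?(ltW x0)// ler_wpDr//
    ler_norm.
  have -> : (`|q`_1| + 1) * x = - q`_0 / 2.
    by rewrite /x; field; rewrite gt_eqF// ltr_wpDl.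
  lra.
Qed.

End polynomial_endgame.

(** * The characterisation *)

Section characterisation.
Context {R : realType}.
Variables (N : nat) (f : R -> R).
Implicit Types (x y t : R).

Lemma k_stieltjesE : k_stieltjes N.+2 f <->
  [/\ forall x, 0 < x -> 0 <= f x, class_C N.*2.+1 f,
    forall n x, (n <= N)%N -> 0 < x ->
      0 <= st_level n f x & convex_pos (st_convex N f)].
Proof.
have e1 : (2 * N.+2 - 3 = N.*2.+1)%N by lia.
have e2 n : (2 * n.+1 - 1 = n.*2.+1)%N by lia.
split=> [[f0 _ /(_ isT)]|[f0 Cf Gf cT]].
  rewrite e1 => -[Cf Gf cT]; split => //.
    by move=> n x nN x0; have := Gf n.+1 x; rewrite e2 !subn1 /= => H; exact: H.
  by move: cT => /convex_functionP; rewrite subn1.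
split => // _; rewrite e1; split => //.
  move=> [//|n] x /andP[_]; rewrite subn1 /= ltnS => nN x0.
  by rewrite e2 subn1 /=; exact: Gf.
by apply/convex_functionP; rewrite subn1.
Qed.

Lemma continuous_derive_Xn m n x : class_C m.+1 f -> 0 < x ->
  {for x, continuous (derive_Xn n m.+1 f)}.
Proof.
move=> Cf x0; have sf := class_C_jet Cf.
elim: n => [|n ih]; first by rewrite derive_X0; exact: Cf.2.
have H := is_derive_continuous (derive_Xn_jet n sf (ltnSn m) x0).
apply: (@near_eq_continuous _ (fun y =>
  y * derive_Xn n m.+1 f y + m.+1%:R * derive_Xn n m f y)).
  near=> y; rewrite (derive_XnS _ sf)//.
  by near: y; exact: near_gt0.
apply: cvgD; first by apply: cvgM => //; exact: cvg_id.
by apply: cvgM => //; exact: cvg_cst.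
Unshelve. all: by end_near. Qed.

Lemma derive_Xn_cst (a : R) n j x : 0 < x ->
  derive_Xn n j (cst a) x = a * (x ^+ (n - j) *+ n ^_ j).
Proof.
move=> x0.
have jp : jet j (fun j x => (derivn j ('X^n * a%:P)).[x]).
  by move=> i y _ _; rewrite derivnS; exact: is_derive_poly.
rewrite /derive_Xn (jet_derive1n _ jp (leqnn _) x0); last first.
  by move=> y _; rewrite derivn0 hornerM hornerXn hornerC.
by rewrite mulrC mul_polyC derivnZ derivnXn hornerZ hornerMn hornerXn.
Qed.

Lemma smooth_cst m (a : R) : smooth m (cst a : R -> R).
Proof.
apply: (@jet_of_derive1n _ _ (fun j x => (derivn j (a%:P)).[x])).
  by move=> x _; rewrite derivn0 hornerC.
by move=> i y _ _; rewrite derivnS; exact: is_derive_poly.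
Qed.

Section representation_suffices.
Variables (a : R) (mu : {measure set (measurableTypeR R) -> \bar R}).
Hypothesis a0 : 0 <= a.
Hypothesis f0 : forall x, 0 < x -> 0 <= f x.
Hypothesis mu_fin : (\int[mu]_(t in `[0%R, +oo[) ((1 + t)^-1)%:E < +oo)%E.
Hypothesis fE : forall x, 0 < x -> ((f x)%:E =
  a%:E + \int[mu]_(t in `[0%R, +oo[) (stieltjes_Phi N.+1 x t)%:E)%E.

Let D : set (measurableTypeR R) := `[0%R, +oo[%classic.

Let mD : measurable D. Proof. exact: measurable_itv. Qed.

Let D0 t : D t -> 0 <= t.
Proof. by rewrite /D /= in_itv/= andbT. Qed.

Let intD : mu.-integrable D (fun t => ((1 + t)^-1)%:E).
Proof.
apply/integrableP; split; first exact: measurable_weight.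
rewrite (eq_integral (fun t : measurableTypeR R => ((1 + t)^-1)%:E))//.
by move=> t; rewrite inE => /D0 t0 /=; rewrite ger0_norm// invr_ge0 addr_ge0.
Qed.

Let I := st_potential mu D N.

Let fI x : 0 < x -> cst a x + 1 * I x = f x.
Proof.
move=> x0; apply: EFin_inj; rewrite fE// EFinD mul1r /I /st_potential /Rintegral
  fineK//.
exact: (integrable_fin_num mD (integrable_Phi_on N mD D0 intD x0)).
Qed.

(** The constant contributes to the first level only, and it is affine at the
    top level. *)
Lemma k_stieltjes_of_representation : k_stieltjes N.+2 f.
Proof.
have sI : smooth N.*2.+1 I by exact: smooth_st_potential.
have sa : smooth N.*2.+1 (cst a : R -> R) by exact: smooth_cst.
have wE n j x : (j <= N.*2.+1)%N -> 0 < x ->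
    derive_Xn n j f x = derive_Xn n j (cst a) x + derive_Xn n j I x.
  move=> jN x0; rewrite -(derive_Xn_germ _ _ fI)// (derive_XnDZ _ _ sa sI)//.
  by rewrite mul1r.
have sf : smooth N.*2.+1 f.
  by apply: jet_of_derive1n (smoothDZ 1 sa sI) => x x0; exact/esym/fI.
apply/k_stieltjesE; split => //.
- split; first by move=> j x jN x0; have [] := sf j x jN x0.
  move=> x x0.
  have CI : {for x, continuous (derive_Xn 0 N.*2.+1 I)}.
    by rewrite derive_X0; have [_] := class_C_st_potential mD D0 intD N; apply.
  apply: (@near_eq_continuous _ (fun y => cst 0 y + derive_Xn 0 N.*2.+1 I y)).
    near=> y; have y0 : 0 < y by near: y; exact: near_gt0.
    by rewrite -derive_X0 wE// derive_Xn_cst// ffact_small// mulr0n mulr0.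
  by apply: cvgD => //; exact: cvg_cst.
- move=> n x nN x0; rewrite /st_level wE// ?ltnS ?leq_double// mulrDr.
  apply: addr_ge0; last exact: (st_level_potential_ge0 mD D0 intD).
  rewrite derive_Xn_cst//; case: n nN => [|n] nN.
    by rewrite expr0 mul1r ffactnn mulr1n subnn expr0 mulr1.
  by rewrite ffact_small ?mulr0n ?mulr0//; lia.
- apply: (@convex_pos_eq _ (fun x => st_convex N (cst a) x + st_convex N I x)).
    by move=> x x0; rewrite /st_convex wE// mulrDr.
  apply: convex_posD; last exact: (convex_pos_st_potential mD D0 intD).
  apply: (@convex_pos_eq _ (fun x =>
    (-1) ^+ N.+1 * (a * (x ^+ (N.+2 - N.*2.+1) *+ N.+2 ^_ N.*2.+1)))).
    by move=> x x0; rewrite /st_convex derive_Xn_cst.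
  case: (N) => [|n] x y z x0 xy yz.
    by rewrite !expr1; lra.
  rewrite (_ : (n.+3 - n.+1.*2.+1 = 0)%N); last by lia.
  by rewrite !expr0; lra.
Unshelve. all: by end_near. Qed.

End representation_suffices.

Section representation_exists.
Hypothesis kf : k_stieltjes N.+2 f.

Lemma representation_of_k_stieltjes :
  exists (a : R) (mu : {measure set (measurableTypeR R) -> \bar R}),
    [/\ 0 <= a,
        (\int[mu]_(t in `[0%R, +oo[) ((1 + t)^-1)%:E < +oo)%E
      & forall x : R, 0 < x ->
          ((f x)%:E =
           a%:E + \int[mu]_(t in `[0%R, +oo[) (stieltjes_Phi N.+1 x t)%:E)%E].
Proof.
have [f0 Cf Gf cT] := k_stieltjesE.1 kf.
have sf : smooth N.*2.+1 f by exact: class_C_jet.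
have ct x : 0 < x -> {for x, continuous (st_convex N f)}.
  by move=> x0; apply: cvgMr; exact: continuous_derive_Xn.
have [mu [mu0 muE]] := representing_measure_ex N cT ct.
pose D : set (measurableTypeR R) := `]0%R, +oo[%classic.
have mD : measurable D by exact: measurable_itv.
have D0 t : D t -> 0 <= t by rewrite /D /= in_itv/= andbT => /ltW.
have intD : mu.-integrable D (fun t => ((1 + t)^-1)%:E).
  exact: (integrable_pos sf f0 Gf cT muE).
pose I := st_potential mu D N.
have sI : smooth N.*2.+1 I by exact: smooth_st_potential.
have IE x : 0 < x -> (I x)%:E = (\int[mu]_(t in D) (stieltjes_Phi N.+1 x t)%:E)%E.
  move=> x0; rewrite /I /st_potential /Rintegral fineK//.
  exact: (integrable_fin_num mD (integrable_Phi_on N mD D0 intD x0)).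
pose w x := f x + -1 * I x.
have sw : smooth N.*2.+1 w by exact: smoothDZ.
have w0 x : 0 < x -> 0 <= w x.
  move=> x0; rewrite /w mulN1r subr_ge0 -lee_fin IE//.
  exact: (integral_Phi_le sf f0 Gf cT muE).
have Gw n x : (n <= N)%N -> 0 < x -> 0 <= st_level n w x.
  exact: (descent_minus sf Gf cT muE mD D0 intD).
have [a [b abE]] : exists a b, forall x, 0 < x ->
  st_convex N f x - st_convex N I x = a * x + b.
  apply: (affine_subtract mD D0 intD cT) => [x y x0 xy|x y x0 xy].
    exact: (tail_mass_diff_le muE mD D0 intD).
  rewrite (tail_mass_diff N mD D0 intD)// (_ : D `&` _ = `]x, y]%classic).
    by rewrite /Rintegral muE.
  apply/seteqP; split=> [t []//|t xyt]; split => //.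
  by move: xyt; rewrite /D /= !in_itv/= andbT => /andP[xt _]; exact: lt_trans xt.
have [q sq qE] : exists2 q : {poly R}, (size q <= 2 + N.*2.+1)%N &
    forall x, 0 < x -> derive_Xn N.+2 0 w x = q.[x].
  have [|q sq qE] := @jet_poly _ _ _ ((-1) ^+ N.+1 *: (a *: 'X + b%:P)) (derive_Xn_jet
    N.+2 sw).
    move=> x x0; rewrite !hornerE -abE//.
    have -> : st_convex N f x - st_convex N I x = st_convex N w x.
      by rewrite (st_convex_DZ mD D0 intD)// mulN1r.
    by rewrite /st_convex mulrA -exprD addnn -signr_odd odd_double expr0 mul1r.
  exists q => //; apply: leq_trans sq _; rewrite leq_add2r.
  apply: leq_trans (size_scale_leq _ _) _.
  apply: leq_trans (size_polyD _ _) _; rewrite geq_max.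
  rewrite (leq_trans (size_scale_leq _ _)) ?size_polyX//=.
  by rewrite (leq_trans (size_polyC_leq1 _)).
have [a' [b' [a'0 b'0 wE]]] := polynomial_remainder sw w0 Gw sq qE.
have A0 := @inner_poly0_gt0 R N.
have c0 : 0 <= b' / (inner_poly N.+1)`_0 by rewrite divr_ge0// ltW.
(* Phi(x, 0) = P(0) / x, so this mass at 0 contributes b' / x. *)
pose m0 : {measure set (measurableTypeR R) -> \bar R} :=
  mscale (NngNum c0) (\d_(0 : measurableTypeR R)).
pose mu' : {measure set (measurableTypeR R) -> \bar R} := measure_add mu m0.
have mE : measurable (`[0%R, +oo[%classic : set (measurableTypeR R)) by exact:
  measurable_itv.
have mu'E (h : measurableTypeR R -> R) :
    (forall t, 0 <= t -> 0 <= h t) ->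
    measurable_fun (`[0%R, +oo[%classic : set (measurableTypeR R)) (fun t =>
      (h t)%:E) ->
    (\int[mu']_(t in `[0%R, +oo[) (h t)%:E =
     \int[mu]_(t in D) (h t)%:E + (b' / (inner_poly N.+1)`_0 * h 0)%:E)%E.
  move=> h0 mh.
  have h0' t : (`[0%R, +oo[%classic : set (measurableTypeR R)) t -> (0 <= (h t)%:E)%E.
    by rewrite /= in_itv/= andbT lee_fin; exact: h0.
  rewrite ge0_integral_measure_add//; congr (_ + _)%E.
    rewrite (@ge0_negligible_integral _ (measurableTypeR R) _ mu _ (`]-oo, 0%R]%classic
      : set (measurableTypeR R)))//.
    congr (integral _ _ _); apply/seteqP; split=> t; rewrite /D /= !in_itv/= !andbT.
      by move=> [_ /negP]; rewrite -ltNge.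
    by move=> t0; split; [exact: ltW|apply/negP; rewrite -ltNge].
  rewrite ge0_integral_mscale// integral_dirac// diracE mem_set/= ?in_itv/= ?lexx//.
  by rewrite mul1e.
exists a', mu'; split => //.
- rewrite mu'E.
  + rewrite lte_add_pinfty ?ltry//.
    have /integrableP[_] := intD; rewrite (eq_integral (fun t : measurableTypeR R =>
      ((1 + t)^-1)%:E))//.
    by move=> t; rewrite inE => /D0 t0 /=; rewrite ger0_norm// invr_ge0 addr_ge0.
  + by move=> t t0; rewrite invr_ge0 addr_ge0.
  + by apply: measurable_weight => t; rewrite /= in_itv/= andbT.
- move=> x x0; rewrite mu'E.
  + rewrite -IE// -!EFinD; congr EFin.
    rewrite Phi_at0// mulrA divfK ?gt_eqF//.
    by have := wE x x0; rewrite /w mulN1r; lra.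
  + by move=> t; exact: Phi_ge0.
  + by apply: measurable_funTS; exact: measurable_Phi.
Qed.

End representation_exists.
End characterisation.

Theorem theorem1 (R : realType) (k : nat) (hk : (2 <= k)%N) (f : R -> R)
    (hf : forall x : R, 0 < x -> 0 <= f x) :
  k_stieltjes k f <->
  exists (a : R) (mu : {measure set (measurableTypeR R) -> \bar R}),
    [/\ 0 <= a,
        (\int[mu]_(t in `[0%R, +oo[) ((1 + t)^-1)%:E < +oo)%E
      & forall x : R, 0 < x ->
          ((f x)%:E =
           a%:E + \int[mu]_(t in `[0%R, +oo[) (stieltjes_Phi (k - 1) x t)%:E)%E].
Proof.
case: k hk => [//|[//|N]] _; rewrite subn1 /=; split.
  exact: representation_of_k_stieltjes.
by move=> [a [mu [a0 mu_fin fE]]]; exact: (k_stieltjes_of_representation a0 hf mu_fin fE).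
Qed.
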